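(* Let $0 < \sigma < 1/6$, let $\alpha \in \mathfrak m_\sigma$ (the set of minor arcs, depending on $X$ and $\sigma$, defined in the context), and let $\xi_{r,s}$ be complex numbers with $|\xi_{r,s}| \ll (rs)^{\epsilon}$. Then $$\sum_{r \sim R}\ \sum_{s \sim S}\ \sum_{rsm \sim X} \xi_{r,s}\, e(\alpha r^2 s^2 m^2) \ll X^{1-\sigma+\epsilon},$$ provided that $R \ll X^{1-3\sigma}$ and $RS^2 \le 0.1\, X^{1-2\sigma}$.
   Context: Here $X \ge 1$ and $R,S>0$ are real numbers; $r,s,m$ run over positive integers; $e(x) = \exp(2\pi i x)$; and $m \sim M$ means $M < m \le 2M$ (so the innermost sum is over $m$ with $X < rsm \le 2X$). Minor arcs: for $1 \le Q \le X$ put $$\mathfrak M(Q) = \bigcup_{1 \le q \le Q}\ \bigcup_{\substack{1 \le a \le q \\ \gcd(a,q)=1}} \left[\frac aq - \frac{Q}{qX^2},\ \frac aq + \frac{Q}{qX^2}\right],$$ and, with $Q = X^{4\sigma}$, $$\mathfrak m_\sigma = \left[QX^{-2},\, 1+QX^{-2}\right] \setminus \mathfrak M(Q).$$ Convention on $\epsilon$ and $\ll$: $f \ll g$ means $|f| \le C g$ for some constant $C>0$. The letter $\epsilon$ denotes a sufficiently small positive real number; any statement in which $\epsilon$ occurs holds for each fixed $\epsilon>0$, with implied constants allowed to depend on $\epsilon$. Thus the hypothesis on the coefficients is that for each $\epsilon>0$ there is a constant $A_\epsilon$ with $|\xi_{r,s}| \le A_\epsilon (rs)^\epsilon$ for all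 $r,s$, and the conclusion holds for each $\epsilon>0$ with an implied constant that may depend on $\epsilon$, on the fixed number $\sigma$, and on the implied constants in the hypotheses, but not on $X, R, S, \alpha$ or otherwise on the coefficients. *)

(* Defs.v *)
From mathcomp Require Import all_boot all_order all_algebra complex.
From mathcomp Require Import all_classical all_reals all_analysis.

Set Implicit Arguments.
Unset Strict Implicit.
Unset Printing Implicit Defensive.

Import Order.TTheory GRing.Theory Num.Theory.
Local Open Scope classical_set_scope.
Local Open Scope ring_scope.
Local Open Scope complex_scope.

Definition e {K : realType} (x : K) : K[i] :=
  cos (2 * pi * x) +i* sin (2 * pi * x).

(* n ~ M *)
Definition dyadic {K : realType} (M : K) (n : nat) : bool :=
  M < n%:R <= 2 * M.

Definition major_arc {K : realType} (X Q : K) (a q : nat) : set K :=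
  `[a%:R / q%:R - Q / (q%:R * X ^+ 2), a%:R / q%:R + Q / (q%:R * X ^+ 2)].

Definition major_arcs {K : realType} (X Q : K) : set K :=
  \bigcup_(q in [set q : nat | (1 <= q)%N /\ q%:R <= Q])
    \bigcup_(a in [set a : nat | (1 <= a <= q)%N /\ coprime a q])
      major_arc X Q a q.

Definition minor_arcs {K : realType} (sigma X : K) : set K :=
  let Q := X `^ (4 * sigma) in
  `[Q / X ^+ 2, 1 + Q / X ^+ 2] `\` major_arcs X Q.

(* The upper limits of the index ranges only make the sums finite: they are
   implied by the dyadic conditions, using r * s >= 1 for the innermost sum. *)
Definition type_I_sum {K : realType} (X R S alpha : K)
    (xi : nat -> nat -> K[i]) : K[i] :=
  \sum_(1 <= r < (Num.truncn (2 * R)).+1 | dyadic R r)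
    \sum_(1 <= s < (Num.truncn (2 * S)).+1 | dyadic S s)
      \sum_(1 <= m < (Num.truncn (2 * X)).+1 | dyadic X (r * s * m)%N)
        xi r s * e (alpha * r%:R ^+ 2 * s%:R ^+ 2 * m%:R ^+ 2).

(* Main.v *)
Require Import Defs.
From mathcomp Require Import all_boot all_order all_algebra complex.
From mathcomp Require Import all_classical all_reals all_analysis.
From mathcomp Require Import ring lra zify.

(** Put x = X^sigma, let H be a small multiple of x^2, and write ||y|| for the
    distance of y to the nearest integer.

    For given r and s the sum over m is a quadratic Weyl sum of length at most
    P = 3 X / (r s) and frequency r^2 s^2 alpha. Weyl differencing bounds it, up
    to a logarithm, by P (H^(-1/2) + D(r,s)^(-1/2)), where
    D(r,s) = q + P^2 |q r^2 s^2 alpha - a| for some reduced fraction a/q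
    ([weyl_bound]). The first term already has the required size X^(1-sigma)
    after summation, so only pairs with D(r,s) < H are of interest, those for
    which r^2 s^2 alpha is very close to a fraction with a small denominator.

    For fixed r, let c/p be a Dirichlet approximation of r^2 alpha. The
    hypothesis on R S^2 makes a/q and s^2 c/p so close that they coincide.
    Hence q = p/t with t | s^2, and D(r,s) = D(r)/t, where D(r) is the analogous
    quantity for r^2 alpha and c/p. As t | s^2 holds for at most 2 S / sqrt t
    values of s, the sum of D(r,s)^(-1/2) over these s is at most 2 S d(p) D(r)^(-1/2)
    ([descent_sum]).

    It remains to sum D(r)^(-1/2) over r. If R^2 <= X / x^2, the same descent
    compares r^2 alpha with one approximation of alpha, whose size is at least
    x^4 / 2 on the minor arcs. For larger R, an r with D(r) < H provides some
    q <= H with ||q r^2 alpha|| <= delta = 4 H R^2 / (3 X)^2. Cauchy's inequality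
    over q reduces the question to pairs r1 < r2 with the same q; then
    n = q (r2 - r1) (r2 + r1) satisfies ||n alpha|| <= 2 delta, at most d(n)^2
    triples give the same n, and such n are counted with an approximation of
    alpha of denominator between x^4 / 2 and 2 X^2 / x^4, as the minor arcs
    permit ([large_sum]). The hypothesis R << X^(1-3 sigma) bounds the expected
    number of these n, and sigma < 1/6 makes the two ranges of R overlap.

    Logarithms and divisor functions are absorbed into X^epsilon
    ([ln_le_powR], [divisor_bound]). *)

Set Implicit Arguments.
Unset Strict Implicit.
Unset Printing Implicit Defensive.

Import Order.TTheory GRing.Theory Num.Theory.
Local Open Scope classical_set_scope.
Local Open Scope ring_scope.
Local Open Scope complex_scope.

(** * Rational approximation *)

(** Pigeonhole on the fractional parts of 0, b, 2 b, .., n b in n boxes of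
    length 1/n: two of them, for i < j, share a box, and q = j - i works up to
    dividing by a gcd. The strict inequality matters on the minor arcs, whose
    definition excludes closed intervals. *)
Lemma dirichlet_approximation (K : realType) (b : K) (n : nat) :
  0 <= b -> (0 < n)%N ->
  exists a q : nat,
    [/\ (0 < q <= n)%N, coprime a q & `|q%:R * b - a%:R| < n%:R^-1].
Proof.
move=> b0 n0.
pose fl k := Num.truncn (k%:R * b); pose fr k := k%:R * b - (fl k)%:R.
have kb0 k : 0 <= k%:R * b by rewrite mulr_ge0.
have fr01 k : 0 <= fr k < 1.
  by have := truncn_itv (kb0 k); rewrite -/(fl k) /fr -natr1; lra.
have nr0 : 0 < n%:R :> K by rewrite ltr0n.
have nfr0 k : 0 <= n%:R * fr k by rewrite mulr_ge0 //; case/andP: (fr01 k).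
have fP k : (Num.truncn (n%:R * fr k) < n)%N.
  by rewrite truncn_lt_nat // gtr_pMr //; case/andP: (fr01 k).
pose f (k : 'I_n.+1) := Ordinal (fP k).
have [i [j [ltij eqf]]] : exists i j : 'I_n.+1, (i < j)%N /\ f i = f j.
  apply: contrapT => nex.
  have injf : injective f.
    move=> i j eqf; apply/val_inj; case: (ltngtP i j) => // lt; case: nex.
      by exists i, j.
    by exists j, i.
  by have := leq_card f injf; rewrite !card_ord ltnn.
(* two points of a half-open box of length 1/n *)
have close : `|fr j - fr i| < n%:R^-1.
  rewrite -(ltr_pM2l nr0) mulfV ?gt_eqF// -{1}(gtr0_norm nr0) -normrM mulrBr.
  have := truncn_itv (nfr0 i); have := truncn_itv (nfr0 j).
  have /(congr1 val) /= -> := eqf.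
  by rewrite ltr_norml -natr1; lra.
have flij : (fl i <= fl j)%N.
  by apply: le_truncn; rewrite ler_wpM2r // ler_nat ltnW.
pose q0 := (j - i)%N; pose a0 := (fl j - fl i)%N; pose g := gcdn a0 q0.
have q0_gt0 : (0 < q0)%N by rewrite subn_gt0.
have g0 : (0 < g)%N by rewrite gcdn_gt0 q0_gt0 orbT.
have Eq : (q0 = q0 %/ g * g)%N by rewrite divnK // dvdn_gcdr.
have Ea : (a0 = a0 %/ g * g)%N by rewrite divnK // dvdn_gcdl.
exists (a0 %/ g)%N, (q0 %/ g)%N; split.
- rewrite divn_gt0 // dvdn_leq ?dvdn_gcdr //=.
  by apply: leq_trans (leq_div _ _) _; rewrite /q0; have := ltn_ord j; lia.
- by rewrite /coprime -(eqn_pmul2r g0) muln_gcdl -Ea -Eq mul1n.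
- apply: le_lt_trans close.
  have -> : fr j - fr i = ((q0 %/ g)%N%:R * b - (a0 %/ g)%N%:R) * g%:R.
    rewrite mulrBl mulrAC -!natrM -Ea -Eq /q0 /a0 !natrB ?(ltnW ltij) // /fr.
    by ring.
  by rewrite normrM ler_peMr // normr_nat ler1n.
Qed.

(** The distance to the nearest integer, usually written ||x||. *)
Definition dint {K : realType} (x : K) : K :=
  `|x - (Num.floor (x + 1 / 2))%:~R|.

Section Dint.
Variable K : realType.
Implicit Types x y : K.

Lemma dint_ge0 x : 0 <= dint x. Proof. exact: normr_ge0. Qed.

Lemma dint_half x : dint x <= 1 / 2.
Proof.
rewrite /dint ler_norml.
have := floor_itv (x + 1 / 2); rewrite intrD1; lra.
Qed.

Lemma dint_le x (z : int) : dint x <= `|x - z%:~R|.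
Proof.
case: (eqVneq z (Num.floor (x + 1 / 2))) => [-> //|nz].
apply: le_trans (dint_half x) _; rewrite leNgt; apply/negP.
rewrite ltr_norml => /andP[h1 h2]; move/eqP: nz; apply.
by apply/esym/floor_def; rewrite intrD1; lra.
Qed.

Lemma dint_leN x (n : nat) : dint x <= `|x - n%:R|.
Proof. exact: (dint_le x (Posz n)). Qed.

Lemma dintP x : exists z : int, dint x = `|x - z%:~R|.
Proof. by eexists. Qed.

Lemma dintB x y : dint (x - y) <= dint x + dint y.
Proof.
have [a ->] := dintP x; have [b ->] := dintP y.
apply: le_trans (dint_le _ (a - b)) _.
rewrite intrB (_ : _ - _ = (x - a%:~R) - (y - b%:~R)); last by ring.
exact: ler_normB.
Qed.

Lemma dint_lip x y : dint x <= dint y + `|x - y|.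
Proof.
have [b ->] := dintP y; apply: le_trans (dint_le _ b) _.
rewrite [x - b%:~R](_ : _ = (y - b%:~R) + (x - y)); last by ring.
exact: ler_normD.
Qed.

Lemma dint_small x : `|x| <= 1 / 2 -> dint x = `|x|.
Proof.
move=> hx; apply/eqP; rewrite eq_le; apply/andP; split.
  by have := dint_le x 0; rewrite subr0.
have [z Ez] := dintP x; have [z0|z0] := eqVneq z 0; first by rewrite Ez z0 subr0.
rewrite Ez; have : 1 <= `|z%:~R : K|.
  by rewrite -intr_norm (ler_int K 1) -gtz0_ge1 normr_gt0.
have := lerB_dist z%:~R x; rewrite distrC; lra.
Qed.

Lemma dint_shift x (z : int) : dint (x + z%:~R) = dint x.
Proof.
apply/eqP; rewrite eq_le; apply/andP; split.
  have [a ->] := dintP x; apply: le_trans (dint_le _ (a + z)) _.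
  by rewrite intrD le_eqVlt; apply/orP; left; apply/eqP; congr `|_|; ring.
have [a ->] := dintP (x + z%:~R); apply: le_trans (dint_le _ (a - z)) _.
by rewrite intrB le_eqVlt; apply/orP; left; apply/eqP; congr `|_|; ring.
Qed.

End Dint.

(** * Multiples of a number close to a fraction *)

Section FractionSums.
Variable K : realType.
Implicit Types b : K.

Lemma harmonic_le (n : nat) : (0 < n)%N ->
  \sum_(1 <= u < n.+1) (u%:R : K)^-1 <= 1 + ln n%:R.
Proof.
elim: n => // -[_ _|n IH _]; first by rewrite big_nat1 ln1 invr1 addr0.
rewrite big_nat_recr //=; have {}IH := IH isT.
have m0 : 0 < n.+1%:R :> K by rewrite ltr0n.
have M0 : 0 < n.+2%:R :> K by rewrite ltr0n.
have M1 : n.+2%:R = 1 + n.+1%:R :> K by rewrite addrC natr1.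
have E : 1 + - n.+2%:R^-1 = n.+1%:R / n.+2%:R :> K.
  by rewrite M1; field; have := ltr0n K n.+2; rewrite M1 => /lt0r_neq0.
have : ln (1 + - n.+2%:R^-1 : K) <= - n.+2%:R^-1.
  by apply: le_ln1Dx; rewrite ltrN2 invf_lt1 // ltr1n.
rewrite E ln_div ?posrE // => h.
have W (A B C D : K) : A <= 1 + B -> B - C <= - D -> A + D <= 1 + C by lra.
exact: W IH h.
Qed.

Lemma dint_frac_ge (u q : nat) : (0 < q)%N ->
  (u%:R / q%:R <= dint (u%:R / q%:R : K)) || (1 - u%:R / q%:R <= dint (u%:R / q%:R : K)).
Proof.
move=> q0; have [z ->] := dintP (u%:R / q%:R : K).
have [z0|z0] := lerP z 0.
  have : z%:~R <= 0 :> K by rewrite lerz0.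
  by move=> h; apply/orP; left; rewrite ler_normr; apply/orP; left; lra.
have : 1 <= z%:~R :> K by rewrite (ler_int K 1) -gtz0_ge1.
by move=> h; apply/orP; right; rewrite ler_normr; apply/orP; right; lra.
Qed.

Lemma dint_frac_inv (u q : nat) : (0 < u < q)%N ->
  (dint (u%:R / q%:R : K))^-1 <= q%:R * (u%:R^-1 + (q - u)%N%:R^-1).
Proof.
move=> /andP[u0 uq]; have q0 : (0 < q)%N by apply: leq_ltn_trans uq.
have U0 : 0 < u%:R :> K by rewrite ltr0n.
have Q0 : 0 < q%:R :> K by rewrite ltr0n.
have V0 : 0 < (q - u)%N%:R :> K by rewrite ltr0n subn_gt0.
have := dint_frac_ge u q0.
have -> : 1 - u%:R / q%:R = (q - u)%N%:R / q%:R :> K.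
  by rewrite natrB ?(ltnW uq) // mulrBl mulfV // gt_eqF.
rewrite mulrDr => /orP[] h.
  apply: (@le_trans _ _ (q%:R / u%:R)).
    by rewrite -[q%:R / u%:R]invf_div lef_pV2 ?posrE ?divr_gt0 // (lt_le_trans _ h)
      ?divr_gt0.
  by rewrite lerDl divr_ge0 // ltW.
apply: (@le_trans _ _ (q%:R / (q - u)%N%:R)).
  by rewrite -[q%:R / (q - u)%:R]invf_div lef_pV2 ?posrE ?divr_gt0 // (lt_le_trans _ h)
    ?divr_gt0.
by rewrite lerDr divr_ge0 // ltW.
Qed.

(** Since ||u/q|| is u/q or (q-u)/q, both halves of the sum are harmonic. *)
Lemma residue_sum (q : nat) : (0 < q)%N ->
  \sum_(u < q | ~~ (q %| u)%N) (dint (u%:R / q%:R : K))^-1 <=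
  2 * q%:R * (1 + ln q%:R).
Proof.
case: q => // q _.
rewrite big_mkcond big_ord_recl dvdn0 /= add0r.
apply: (@le_trans _ _ (\sum_(i < q) (q.+1%:R : K) * (i.+1%:R^-1 + (q.+1 - i.+1)%N%:R^-1))).
  apply: ler_sum => i _.
  case: ifP => _; last by rewrite mulr_ge0 // addr_ge0 // invr_ge0.
  by apply: dint_frac_inv; rewrite /= /bump /= add1n ltnS ltn_ord.
rewrite -mulr_sumr big_split /= mulrAC -mulrA mulrC.
rewrite mulrA ler_pM2r ?ltr0n //.
have H : \sum_(i < q) (i.+1%:R : K)^-1 <= 1 + ln q.+1%:R.
  case: q => [|q]; first by rewrite big_ord0 ln1 addr0.
  have := @harmonic_le q.+1 isT; rewrite big_add1 /= big_mkord => h.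
  by apply: le_trans h _; rewrite lerD2l ler_ln ?posrE ?ltr0n // ler_nat.
have -> : \sum_(i < q) ((q.+1 - i.+1)%N%:R : K)^-1 = \sum_(i < q) (i.+1%:R : K)^-1.
  rewrite (reindex_inj rev_ord_inj) /=; apply: eq_bigr => i _.
  by congr (_%:R^-1); have := ltn_ord i; lia.
lra.
Qed.

(** Multiplication by a permutes the residues modulo q. *)
Lemma residue_sum_coprime (a q : nat) : (0 < q)%N -> coprime a q ->
  \sum_(j < q | ~~ (q %| j)%N) (dint ((j * a)%N%:R / q%:R : K))^-1 <=
  2 * q%:R * (1 + ln q%:R).
Proof.
move=> q0 cop; apply: le_trans (residue_sum q0).
have hP (j : 'I_q) : ((j * a) %% q < q)%N by rewrite ltn_mod.
pose h j := Ordinal (hP j).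
have hinj : injective h.
  move=> i j /(congr1 val) /= E; apply/val_inj => /=.
  wlog lij : i j E / (i <= j)%N.
    by move=> W; case: (leqP i j) => l; [exact: W|apply/esym/W => //; exact: ltnW].
  move/eqP: E; rewrite eq_sym eqn_mod_dvd ?leq_mul2r ?lij ?orbT // -mulnBl.
  rewrite Gauss_dvdl 1?coprime_sym // => d.
  have : (j - i < q)%N by have := ltn_ord j; lia.
  by move=> /(modn_small); move/eqP: d => -> ; lia.
rewrite [leRHS](reindex_inj hinj) /=.
rewrite le_eqVlt; apply/orP; left; apply/eqP.
apply: eq_big => [j|j _].
  by rewrite -[in RHS]/(_ %| _)%N [in RHS]/dvdn modn_mod -/(dvdn _ _) Gauss_dvdl
    1?coprime_sym.
have E : (j * a)%N%:R / q%:R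
  = ((j * a) %% q)%N%:R / q%:R + (((j * a) %/ q)%N : int)%:~R :> K.
  rewrite {1}(divn_eq (j * a) q) natrD natrM -pmulrn mulrDl mulfK ?pnatr_eq0 -?lt0n //.
  exact: addrC.
by rewrite E dint_shift.
Qed.

Lemma block_sum (a q k : nat) : (0 < q)%N -> coprime a q ->
  \sum_(0 <= j < k * q | ~~ (q %| j)%N) (dint ((j * a)%N%:R / q%:R : K))^-1 <=
  k%:R * (2 * q%:R * (1 + ln q%:R)).
Proof.
move=> q0 cop; elim: k => [|k IH]; first by rewrite mul0n big_nil mul0r.
rewrite mulSn addnC (big_cat_nat _ (n := (k * q)%N)) ?leq_addr //=.
rewrite -natr1 mulrDl mul1r; apply: lerD => //.
rewrite -{1}[(k * q)%N]add0n big_addn addKn big_mkord.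
apply: le_trans (residue_sum_coprime q0 cop).
rewrite le_eqVlt; apply/orP; left; apply/eqP; apply: eq_big => [j|j _].
  by rewrite dvdn_addl // dvdn_mull.
have -> : ((j + k * q) * a)%N%:R / q%:R = (j * a)%N%:R / q%:R + ((k * a)%N : int)%:~R :> K.
  rewrite mulnDl natrD mulrDl -pmulrn; congr (_ + _).
  by rewrite mulnAC natrM mulfK // pnatr_eq0 -lt0n.
by rewrite dint_shift.
Qed.

Lemma dint_frac_ge_inv (a q j : nat) : (0 < q)%N -> coprime a q -> ~~ (q %| j)%N ->
  q%:R^-1 <= dint ((j * a)%N%:R / q%:R : K).
Proof.
move=> q0 cop nd; have Q0 : 0 < q%:R :> K by rewrite ltr0n.
have [z ->] := dintP ((j * a)%N%:R / q%:R : K).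
rewrite -(ler_pM2r Q0) mulVf ?gt_eqF // -{2}(gtr0_norm Q0) -normrM mulrBl.
rewrite divfK ?gt_eqF // -[(j * a)%N%:R]/((Posz (j * a))%:~R) -[q%:R]/((Posz q)%:~R).
rewrite -intrM -intrB -intr_norm (ler_int K 1) -gtz0_ge1 normr_gt0 subr_eq0.
apply: contra nd => /eqP E; rewrite -(@Gauss_dvdl _ _ a) 1?coprime_sym //.
by have : (q%:Z %| (j * a)%N%:Z)%Z by rewrite E; apply: dvdz_mull.
Qed.

Lemma dint_perturb b (a q j J : nat) : (0 < q)%N -> coprime a q ->
  J%:R * `|q%:R * b - a%:R| <= 1 / 2 -> (j <= J)%N -> ~~ (q %| j)%N ->
  dint ((j * a)%N%:R / q%:R) <= 2 * dint (j%:R * b).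
Proof.
move=> q0 cop hJ jJ nd; have Q0 : 0 < q%:R :> K by rewrite ltr0n.
(* the error j |q b - a| / q is at most half the minimal distance 1/q *)
have h1 := dint_frac_ge_inv q0 cop nd.
have h2 := dint_lip ((j * a)%N%:R / q%:R) (j%:R * b).
have h3 : `|(j * a)%N%:R / q%:R - j%:R * b| <= 1 / 2 * q%:R^-1.
  have -> : (j * a)%N%:R / q%:R - j%:R * b = - (j%:R * (q%:R * b - a%:R)) / q%:R.
    by rewrite natrM; field; rewrite gt_eqF.
  rewrite normrM normrN normrM normfV !normr_nat ler_pM2r ?invr_gt0 //.
  by apply: le_trans hJ; rewrite ler_wpM2r // ler_nat.
lra.
Qed.

(** The multiples of b are distributed modulo 1 like those of a/q as long as
    the accumulated error J |q b - a| / q stays below half of 1/q; J + q bounds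
    the length of the blocks of q consecutive j needed to cover [0, J]. *)
Lemma sum_dint_inv b (a q J : nat) : (0 < q)%N -> coprime a q ->
  J%:R * `|q%:R * b - a%:R| <= 1 / 2 ->
  \sum_(0 <= j < J.+1 | ~~ (q %| j)%N) (dint (j%:R * b))^-1 <=
  4 * (J + q)%N%:R * (1 + ln q%:R).
Proof.
move=> q0 cop hJ; have Q0 : 0 < q%:R :> K by rewrite ltr0n.
have L0 : 0 <= ln (q%:R : K) by rewrite ln_ge0 // ler1n.
pose k := (J %/ q).+1.
have kq : (J.+1 <= k * q)%N by rewrite /k; have := divn_eq J q; have := ltn_pmod J q0; lia.
have kq' : (k * q <= J + q)%N by rewrite /k mulSn addnC leq_add2r leq_divM.
apply: (@le_trans _ _ (2 * \sum_(0 <= j < J.+1 | ~~ (q %| j)%N)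
   (dint ((j * a)%N%:R / q%:R : K))^-1)).
  rewrite mulr_sumr big_nat_cond [leRHS]big_nat_cond; apply: ler_sum => j /andP[jJ nd].
  have h1 := dint_frac_ge_inv q0 cop nd.
  have d0 : 0 < dint ((j * a)%N%:R / q%:R : K) by apply: lt_le_trans h1; rewrite invr_gt0.
  have h2 := dint_perturb q0 cop hJ (jJ : (j <= J)%N) nd.
  have d1 : 0 < dint (j%:R * b) by lra.
  rewrite -[leLHS]mul1r ler_pdivrMr // mulrAC ler_pdivlMr // mul1r; lra.
apply: (@le_trans _ _ (2 * (k%:R * (2 * q%:R * (1 + ln q%:R))))).
  rewrite ler_pM2l //; apply: le_trans (block_sum k q0 cop).
  rewrite [leRHS](big_cat_nat _ (n := J.+1)) //= lerDl.
  by apply: sumr_ge0 => j _; rewrite invr_ge0 dint_ge0.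
have -> : 2 * (k%:R * (2 * q%:R * (1 + ln q%:R))) = 4 * (k * q)%N%:R * (1 + ln q%:R) :> K.
  by rewrite natrM; ring.
rewrite ler_wpM2r ?addr_ge0 // ler_wpM2l // ler_nat //.
Qed.

(** The n divisible by q are counted trivially; any other n with ||n b|| <= d
    contributes at least 1/d to the sum bounded by [sum_dint_inv]. *)
Lemma count_dint_le b (a q J : nat) (d : K) : (0 < q)%N -> coprime a q ->
  J%:R * `|q%:R * b - a%:R| <= 1 / 2 -> 0 < d ->
  \sum_(1 <= n < J.+1 | dint (n%:R * b) <= d) (1 : K) <=
  J%:R / q%:R + d * (4 * (J + q)%N%:R * (1 + ln q%:R)).
Proof.
move=> q0 cop hJ d0; have Q0 : 0 < q%:R :> K by rewrite ltr0n.
have Jq : (J %/ q)%N%:R <= J%:R / q%:R :> K.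
  by rewrite ler_pdivlMr // -natrM ler_nat leq_divM.
rewrite (bigID (fun n => (q %| n)%N)) /=; apply: lerD.
  apply: le_trans Jq; rewrite divn_count_dvd natr_sum big_mkcond.
  by apply: ler_sum => n _; case: (q %| n)%N; rewrite ?andbT ?andbF //; case: ifP.
apply: (@le_trans _ _ (d * \sum_(0 <= j < J.+1 | ~~ (q %| j)%N) (dint (j%:R * b))^-1));
  last first.
  by rewrite ler_pM2l //; exact: (sum_dint_inv q0 cop hJ).
rewrite [in leRHS]big_mkcond [in leRHS]big_ltn // dvdn0 /= add0r -big_mkcond /= mulr_sumr.
rewrite big_mkcond [leRHS]big_mkcond big_nat_cond [leRHS]big_nat_cond;
  apply: ler_sum => j /andP[/andP[_ jJ] _].
case: (boolP (q %| j)%N) => nd; rewrite ?andbF // andbT.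
have := dint_frac_ge_inv q0 cop nd; have := dint_perturb q0 cop hJ (jJ : (j <= J)%N) nd.
have : 0 < (q%:R : K)^-1 by rewrite invr_gt0.
move=> h0 h1 h2; have d1 : 0 < dint (j%:R * b) by lra.
case: ifP => h; last by rewrite mulr_ge0 ?invr_ge0 // ltW.
by rewrite ler_pdivlMr // mul1r.
Qed.
End FractionSums.

(** * The additive character and geometric sums *)

(** The norm of K[i] takes its values in K[i]; [cabs] is the same number in the
    totally ordered field K, where linear arithmetic is available. *)
Definition cabs {K : realType} (z : K[i]) : K := complex.Re `|z|.

Section Modulus.
Import numFieldNormedType.Exports.
Variable K : realType.
Implicit Types (z w : K[i]) (x y : K).

Lemma cabsE z : `|z| = (cabs z)%:C.
Proof. by rewrite /cabs normc_def. Qed.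

Lemma cabs_ge0 z : 0 <= cabs z.
Proof. by rewrite -lecR -cabsE; exact: normr_ge0. Qed.

Lemma cabs0 : cabs (0 : K[i]) = 0. Proof. by rewrite /cabs normr0. Qed.

Lemma cabsD z w : cabs (z + w) <= cabs z + cabs w.
Proof. by rewrite -lecR rmorphD /= -!cabsE ler_normD. Qed.

Lemma cabsM z w : cabs (z * w) = cabs z * cabs w.
Proof. by apply: (@complexI K); rewrite rmorphM /= -!cabsE normrM. Qed.

Lemma cabsJ z : cabs z^*%C = cabs z.
Proof. by apply: (@complexI K); rewrite -!cabsE normcJ. Qed.

Lemma cabs_real x : cabs x%:C = `|x|.
Proof. by rewrite /cabs normc_def /= expr0n addr0 sqrtr_sqr. Qed.

Lemma cabs_sum (I : Type) (r : seq I) (P : pred I) (F : I -> K[i]) :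
  cabs (\sum_(i <- r | P i) F i) <= \sum_(i <- r | P i) cabs (F i).
Proof.
elim/big_rec2: _ => [|i y1 y2 _ h]; first by rewrite cabs0.
by apply: le_trans (cabsD _ _) _; rewrite lerD2l.
Qed.

Lemma cabs_sqr z : cabs z ^+ 2 = complex.Re z ^+ 2 + complex.Im z ^+ 2.
Proof. by apply: (@complexI K); rewrite add_Re2_Im2 cabsE rmorphXn. Qed.

Lemma e_D x y : e (x + y) = e x * e y.
Proof.
rewrite /e mulrDr cosD sinD; apply/eqP; rewrite eq_complex /=.
by apply/andP; split; apply/eqP => //; rewrite addrC mulrC [X in _ + X]mulrC addrC; ring.
Qed.

Lemma e_0 : e (0 : K) = 1.
Proof. by rewrite /e mulr0 cos0 sin0. Qed.

Lemma e_conj x : (e x)^*%C = e (- x).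
Proof. by rewrite /e mulrN cosN sinN. Qed.

Lemma cabs_e x : cabs (e x) = 1.
Proof.
apply/eqP; rewrite -(@eqrXn2 _ 2) ?cabs_ge0 // cabs_sqr /e /=.
by rewrite cos2Dsin2 expr1n.
Qed.

Lemma e_X x (n : nat) : e x ^+ n = e (n%:R * x).
Proof.
elim: n => [|n IH]; first by rewrite mul0r e_0.
by rewrite exprS IH -e_D -natr1 mulrDl mul1r addrC.
Qed.

Lemma e_int x (z : int) : e (x + z%:~R) = e x.
Proof.
have e1 : e (1 : K) = 1.
  by rewrite /e mulr1 (_ : 2 * pi = pi *+ 2) ?cos2pi ?sin2pi // mulr2n mulrDl mul1r.
have en (n : nat) : e (n%:R : K) = 1 by rewrite -[n%:R]mulr1 -e_X e1 expr1n.
rewrite e_D; case: z => n; rewrite -?[in e (_ %:~R)]/(n%:R) ?en ?mulr1 //.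
by rewrite NegzE mulrNz -e_conj en conjc1 mulr1.
Qed.

Lemma sin_MVT x : 0 <= x -> exists2 c, 0 <= c <= x & sin x = cos c * x.
Proof.
move=> x0; have [|c] := MVT_segment x0 (fun y _ => is_derive_sin y).
  exact/continuous_subspaceT/continuous_sin.
by rewrite in_itv /= sin0 !subr0; exists c.
Qed.

Lemma sin_le x : 0 <= x -> sin x <= x.
Proof.
move=> x0; have [c _ ->] := sin_MVT x0; rewrite ler_piMl //; exact: cos_le1.
Qed.

Lemma cos_ge x : 0 <= x -> 1 - x ^+ 2 / 2 <= cos x.
Proof.
move=> x0; have -> : x = (x / 2) *+ 2 by rewrite mulr2n; field.
have h0 : 0 <= x / 2 by lra.
have : sin (x / 2) ^+ 2 <= (x / 2) ^+ 2.
  rewrite -[sin _ ^+ 2]real_normK ?num_real // ler_sqr ?nnegrE //.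
  have [x2|x2] := lerP (x / 2) 1.
    rewrite ger0_norm ?sin_le // sin_ge0_pi // h0 /=; have := pi_ge2 K; lra.
  by apply: le_trans (sin_max _) (ltW x2).
rewrite cos_mulr2n cos2sin2 => h.
have -> : (x / 2 *+ 2) ^+ 2 / 2 = 2 * (x / 2) ^+ 2 by rewrite -mulr_natr; field.
by rewrite [(_ - _) *+ 2]mulr2n; lra.
Qed.

(** Jordan's inequality with a worse constant: on [0, 1] the mean value theorem
    gives sin x >= x / 2, because cos >= 1/2 there, and beyond 1 monotonicity
    of sin suffices since x / pi <= 1/2. *)
Lemma sin_ge x : 0 <= x -> x <= pi / 2 -> x / pi <= sin x.
Proof.
have pi2 := pi_ge2 K; have pi0 := pi_gt0 K.
have small y : 0 <= y -> y <= 1 -> y / 2 <= sin y.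
  move=> y0 y1; have [c /andP[c0 cy] ->] := sin_MVT y0.
  have := cos_ge c0; have : c ^+ 2 <= 1 by rewrite expr_le1 //; lra.
  by move=> h1 h2; rewrite mulrC ler_wpM2r //; lra.
move=> x0 xpi; have [x1|x1] := lerP x 1.
  by apply: le_trans (small _ x0 x1); rewrite ler_wpM2l // lef_pV2 ?posrE.
apply: (@le_trans _ _ (1 / 2)); first by rewrite ler_pdivrMr //; lra.
apply: (le_trans (small 1 _ _)) => //.
have [/ltW h|h] := ltP 1 x; last by lra.
by rewrite le_eqVlt ltr_sin ?x1 ?orbT // in_itv /=; lra.
Qed.

(** |e(x) - 1| = 2 |sin (pi y)| for y = x minus its nearest integer. *)
Lemma e_sub1_ge x : 2 * dint x <= cabs (e x - 1).
Proof.
pose z := Num.floor (x + 1 / 2); pose y := x - z%:~R.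
have -> : e x = e y by rewrite -(e_int y z) /y subrK.
have Ed : dint x = `|y| by [].
have y2 : `|y| <= 1 / 2 by rewrite -Ed dint_half.
have d0 := dint_ge0 x.
rewrite Ed -(@ler_pXn2r _ 2) ?nnegrE ?cabs_ge0 ?mulr_ge0 // cabs_sqr /e /= subr0.
have -> : 2 * pi * y = (pi * y) *+ 2 by rewrite -mulr_natr; ring.
have h : `|y| <= `|sin (pi * y)|.
  have pi0 := pi_gt0 K.
  have {y2} : 0 <= `|y| -> pi * `|y| / pi <= sin (pi * `|y|).
    move=> yy; apply: sin_ge; first by rewrite mulr_ge0 // ltW.
    by rewrite ler_pM2l //; lra.
  rewrite mulrAC mulfV ?gt_eqF // mul1r => /(_ (normr_ge0 _)) h.
  apply: le_trans h _; have [yy|yy] := ger0P y; rewrite ?mulrN ?sinN; first exact: ler_norm.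
  by rewrite -normrN; exact: ler_norm.
have h2 : y ^+ 2 <= sin (pi * y) ^+ 2.
  by rewrite -[y ^+ 2]real_normK ?num_real // -[leRHS]real_normK ?num_real // ler_sqr
    ?nnegrE.
rewrite exprMn real_normK ?num_real //.
set t := pi * y; have E1 := cos2Dsin2 (t *+ 2); have E2 := cos_mulr2n t.
have E3 := cos2Dsin2 t; rewrite -/t in h2.
have -> : (cos (t *+ 2) - 1) ^+ 2 + sin (t *+ 2) ^+ 2 = 2 - 2 * cos (t *+ 2).
  have W (C D : K) : C ^+ 2 + D ^+ 2 = 1 -> (C - 1) ^+ 2 + D ^+ 2 = 2 - 2 * C.
    move=> H; have -> : (C - 1) ^+ 2 + D ^+ 2 = (C ^+ 2 + D ^+ 2) + 1 - 2 * C by ring.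
    by rewrite H.
  exact: W E1.
rewrite E2 -mulr_natr.
have -> : cos t ^+ 2 = 1 - sin t ^+ 2 by rewrite -E3; ring.
lra.
Qed.

(** The bound min (P, 1/||x||) in a smooth form that needs no convention for
    the case ||x|| = 0. *)
Lemma geometric_e_le x (n : nat) (P : K) : 0 < P -> n%:R <= P ->
  cabs (\sum_(i < n) e x ^+ i) <= 2 * (P^-1 + dint x)^-1.
Proof.
move=> P0 nP; set S := \sum_(i < n) _; have d0 := dint_ge0 x.
have Pi : 0 < P^-1 by rewrite invr_gt0.
have Sn : cabs S <= P.
  apply: le_trans (cabs_sum _ _ _) _; apply: le_trans nP.
  rewrite (eq_bigr (fun _ => 1)) ?sumr_const ?card_ord // => i _.
  by rewrite e_X cabs_e.
have Sd : dint x * cabs S <= 1.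
  have : cabs (e x - 1) * cabs S <= 2.
    rewrite -cabsM -subrX1 e_X; apply: le_trans (cabsD _ _) _.
    have -> : cabs (-1 : K[i]) = 1 by rewrite /cabs normrN1.
    by rewrite cabs_e.
  have := ler_wpM2r (cabs_ge0 S) (e_sub1_ge x); lra.
have pos : 0 < P^-1 + dint x by lra.
rewrite ler_pdivlMr // mulrDr.
have : cabs S * P^-1 <= 1 by rewrite ler_pdivrMr // mul1r.
rewrite [cabs S * dint x]mulrC; lra.
Qed.

(** Weyl differencing: in |sum u_i|^2 the terms u_i times the conjugate of u_j
    are grouped by the difference h = i - j, the two signs of h being conjugate. *)
Lemma sqr_norm_sum (u : nat -> K[i]) (n : nat) :
  `|\sum_(0 <= i < n) u i| ^+ 2 = \sum_(0 <= i < n) `|u i| ^+ 2 +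
  \sum_(1 <= h < n) (\sum_(0 <= j < n - h) u (j + h)%N * (u j)^*%C +
                     (\sum_(0 <= j < n - h) u (j + h)%N * (u j)^*%C)^*%C).
Proof.
elim: n => [|n IH].
  by rewrite !big_geq // normr0 expr0n addr0.
pose T m h := \sum_(0 <= j < m - h) u (j + h)%N * (u j)^*%C.
pose S := \sum_(0 <= i < n) u i.
have -> : \sum_(1 <= h < n.+1) (T n.+1 h + (T n.+1 h)^*%C) =
  \sum_(1 <= h < n) (T n h + (T n h)^*%C) + (u n * S^*%C + (u n * S^*%C)^*%C).
  have -> : \sum_(1 <= h < n.+1) (T n.+1 h + (T n.+1 h)^*%C) =
    \sum_(1 <= h < n.+1) ((T n h + (T n h)^*%C) +
       (u n * (u (n - h)%N)^*%C + (u n * (u (n - h)%N)^*%C)^*%C)).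
    apply: eq_big_nat => h /andP[h0 hn].
    have -> : T n.+1 h = T n h + u n * (u (n - h)%N)^*%C.
      by rewrite /T subSn // big_nat_recr //= subnK.
    by rewrite rmorphD /= addrACA.
  rewrite big_split /=; congr (_ + _).
    case: n {IH S} => [|n]; first by rewrite !big_geq.
    have T0 : T n.+1 n.+1 = 0 by rewrite /T subnn big_geq.
    by rewrite big_nat_recr //= T0 conjc0 !addr0.
  rewrite big_split /= -rmorph_sum -mulr_sumr -rmorph_sum.
  suff -> : \sum_(1 <= h < n.+1) u (n - h)%N = S by [].
  rewrite big_add1 /= /S big_nat_rev /=; apply: eq_big_nat => i /andP[_ i_n].
  by congr (u _); lia.
rewrite !big_nat_recr //= -/S addrACA -IH !sqr_normc rmorphD /= rmorphM /= conjcK -/S.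
have W (a b c d : K[i]) : (a + b) * (c + d) = a * c + (b * d + (b * c + d * a)) by ring.
exact: W.
Qed.

(** For a quadratic phase the difference of the phases at j + h and j is affine
    in j with slope 2 h b, so the correlations are geometric sums. *)
Lemma weyl_differencing (b P : K) (n c : nat) : 0 < P -> n%:R <= P ->
  cabs (\sum_(0 <= i < n) e (b * (c + i)%N%:R ^+ 2)) ^+ 2 <=
  P + 4 * \sum_(1 <= h < n) (P^-1 + dint ((2 * h)%N%:R * b))^-1.
Proof.
move=> P0 nP; set u := fun i => e (b * (c + i)%N%:R ^+ 2).
have := sqr_norm_sum u n; set A := \sum_(0 <= i < n) `|u i| ^+ 2.
set B := \sum_(1 <= h < n) _ => E.
have -> : cabs (\sum_(0 <= i < n) u i) ^+ 2 = cabs (A + B).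
  by rewrite -E cabsE -rmorphXn /= cabs_real ger0_norm // sqr_ge0.
apply: le_trans (cabsD _ _) _; apply: lerD.
  apply: le_trans nP; apply: le_trans (cabs_sum _ _ _) _.
  rewrite (eq_bigr (fun _ => 1)) ?sumr_const_nat ?subn0 // => i _.
  by rewrite cabsE cabs_e expr1n /cabs normr1.
rewrite mulr_sumr; apply: le_trans (cabs_sum _ _ _) _.
rewrite big_nat_cond [leRHS]big_nat_cond; apply: ler_sum => h /andP[/andP[h0 hn] _].
set T := \sum_(0 <= j < n - h) _.
apply: le_trans (cabsD _ _) _; rewrite cabsJ.
suff : cabs T <= 2 * (P^-1 + dint ((2 * h)%N%:R * b))^-1 by lra.
have -> : T = e (b * (2 * c * h + h ^ 2)%N%:R) * \sum_(i < n - h) e ((2 * h)%N%:R * b) ^+ i.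
  rewrite mulr_sumr /T big_mkord; apply: eq_bigr => j _.
  rewrite /u e_conj e_X -!e_D; congr e.
  by rewrite !(natrD, natrM, natrX); ring.
rewrite cabsM cabs_e mul1r; apply: geometric_e_le => //.
by apply: le_trans nP; rewrite ler_nat leq_subr.
Qed.
End Modulus.

(** * Weyl's bound for quadratic sums *)

Definition isqrt {K : realType} (x : K) : K := (Num.sqrt x)^-1.

Section WeylBound.
Variable K : realType.

Lemma isqrt_ge0 (x : K) : 0 <= isqrt x.
Proof. by rewrite invr_ge0 sqrtr_ge0. Qed.

Lemma isqrt_sqr (x : K) : 0 <= x -> isqrt x ^+ 2 = x^-1.
Proof. by move=> x0; rewrite exprVn sqr_sqrtr. Qed.

Lemma isqrt_le (x y : K) : 0 < x -> x <= y -> isqrt y <= isqrt x.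
Proof.
by move=> x0 xy; rewrite lef_pV2 ?posrE ?sqrtr_gt0 ?(lt_le_trans x0) // ler_wsqrtr.
Qed.

Lemma sum_multiples (F : nat -> K) (q J : nat) : (0 < q)%N ->
  \sum_(1 <= j < J.+1 | (q %| j)%N) F (j %/ q)%N = \sum_(1 <= k < (J %/ q).+1) F k.
Proof.
move=> q0; elim: J => [|J IH]; first by rewrite div0n !big_geq.
rewrite big_mkcond big_nat_recr //= -big_mkcond /= IH divnS //.
case: (q %| J.+1)%N; last by rewrite addr0.
by rewrite [in RHS]big_nat_recr.
Qed.

Lemma sum_even_le (F : nat -> K) (n : nat) : (forall j, 0 <= F j) ->
  \sum_(1 <= h < n) F (2 * h)%N <= \sum_(1 <= j < (2 * n).+1) F j.
Proof.
move=> F0; apply: (@le_trans _ _ (\sum_(1 <= j < 2 * n) F j)); last first.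
  by case: n => [|n]; [rewrite !big_geq | rewrite [leRHS]big_nat_recr //= lerDl].
elim: n => [|[|n] IH]; first by rewrite !big_geq.
  by rewrite big_geq // sumr_ge0.
have E : (2 * n.+2 = (2 * n.+1).+2)%N by lia.
have m0 : (0 < 2 * n.+1)%N by lia.
rewrite [leLHS]big_nat_recr // E; move: m0 IH; move: (2 * n.+1)%N => m m0 IH.
rewrite [leRHS]big_nat_recr // [X in _ <= _ X _]big_nat_recr //=.
by rewrite -addrA lerD // lerDl.
Qed.

(** The multiples j = k q are the only frequencies for which ||j b|| may be
    tiny; there ||j b|| = k |q b - a|, so the sum is at most P J / q by the
    trivial bound and at most log / |q b - a| by the harmonic one. Both together
    give the factor 1 / (q + P^2 |q b - a|). *)
Lemma multiples_part (b P L : K) (a q J : nat) :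
  (0 < q)%N -> 1 <= P -> 1 <= L -> 1 + ln P <= L ->
  J%:R <= 2 * P -> J%:R * `|q%:R * b - a%:R| <= 1 / 2 ->
  \sum_(1 <= j < J.+1 | (q %| j)%N) (P^-1 + dint (j%:R * b))^-1 <=
  4 * L * (P ^+ 2 / (q%:R + P ^+ 2 * `|q%:R * b - a%:R|)).
Proof.
move=> q0 P1 L1 LP JP hJ; set d := `|_|; have d0 : 0 <= d by exact: normr_ge0.
have P0 : 0 < P by lra.
have Q0 : 0 < q%:R :> K by rewrite ltr0n.
have Q1 : 1 <= q%:R :> K by rewrite ler1n.
have Pi : 0 < P^-1 by rewrite invr_gt0.
set D := q%:R + P ^+ 2 * d.
have P20 : 0 < P ^+ 2 by rewrite exprn_gt0.
have D0 : 0 < D by rewrite /D ltr_pwDl // mulr_ge0 // ltW.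
set kk := (J %/ q)%N.
have kk1 : kk%:R <= J%:R / q%:R :> K by rewrite ler_pdivlMr // -natrM ler_nat leq_divM.
have Ed j : (j <= J)%N -> (q %| j)%N -> dint (j%:R * b) = (j %/ q)%N%:R * d.
  move=> jJ qj; set k := (j %/ q)%N; have -> : j = (k * q)%N by rewrite divnK.
  have -> : (k * q)%N%:R * b = k%:R * (q%:R * b - a%:R) + ((k * a)%N : int)%:~R.
    by rewrite -pmulrn !natrM; ring.
  have E : `|k%:R * (q%:R * b - a%:R)| = k%:R * d by rewrite normrM normr_nat.
  rewrite dint_shift dint_small E //; apply: le_trans hJ.
  by rewrite ler_wpM2r // ler_nat; apply: leq_trans jJ; exact: leq_div.
rewrite (_ : \sum_(1 <= j < J.+1 | (q %| j)%N) (P^-1 + dint (j%:R * b))^-1 =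
  \sum_(1 <= k < kk.+1) (P^-1 + k%:R * d)^-1); last first.
  rewrite -(sum_multiples (fun k => (P^-1 + k%:R * d)^-1)) //.
  rewrite big_nat_cond [RHS]big_nat_cond; apply: eq_bigr => j /andP[/andP[_ jJ] qj].
  by rewrite Ed.
(* whichever of the two terms of D dominates decides between the bounds *)
have [h|h] := lerP (P ^+ 2 * d) q%:R.
  apply: (@le_trans _ _ (kk%:R * P)).
    rewrite mulr_natl -[kk in leRHS](subn1 kk.+1) -sumr_const_nat.
    apply: ler_sum => k _; rewrite -[leRHS]invrK lef_pV2 ?posrE //.
      by rewrite lerDl mulr_ge0.
    by rewrite ltr_pwDl // mulr_ge0.
  apply: (@le_trans _ _ (2 * P ^+ 2 / q%:R)).
    have : kk%:R * P <= (2 * P / q%:R) * P.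
      by rewrite ler_pM2r //; apply: le_trans kk1 _; rewrite ler_pM2r ?invr_gt0.
    by move/le_trans; apply; rewrite le_eqVlt; apply/orP; left; apply/eqP; ring.
  rewrite mulrA ler_pdivlMr // mulrAC ler_pdivrMr // /D.
  have : 2 * P ^+ 2 * (q%:R + P ^+ 2 * d) <= 2 * P ^+ 2 * (2 * q%:R).
    by rewrite ler_pM2l ?mulr_gt0 //; lra.
  have : 4 * P ^+ 2 * q%:R <= 4 * L * P ^+ 2 * q%:R.
    by rewrite ler_pM2r // ler_pM2r // ler_peMr.
  lra.
have dp : 0 < d.
  by rewrite -(pmulr_rgt0 _ P20); exact: lt_trans h.
case: (posnP kk) => [->|kk0].
  by rewrite big_geq // !mulr_ge0 ?invr_ge0 // ?ltW //; lra.
apply: (@le_trans _ _ ((1 + ln kk%:R) / d)).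
  apply: (@le_trans _ _ (\sum_(1 <= k < kk.+1) k%:R^-1 / d)).
    rewrite big_nat_cond [leRHS]big_nat_cond; apply: ler_sum => k /andP[/andP[k0 _] _].
    have k0' : 0 < k%:R :> K by rewrite ltr0n.
    by rewrite -invfM lef_pV2 ?posrE ?addr_gt0 ?mulr_gt0 // mulrC lerDr ltW.
  by rewrite -mulr_suml ler_pM2r ?invr_gt0 //; exact: harmonic_le.
have lnk : 1 + ln kk%:R <= 2 * L.
  have : ln (kk%:R : K) <= ln (2 * P).
    rewrite ler_ln ?posrE ?mulr_gt0 ?ltr0n //.
    apply: le_trans kk1 _; apply: le_trans JP.
    by rewrite ler_pdivrMr // ler_peMr.
  rewrite lnM ?posrE //.
  have : ln (2 : K) <= 1 by rewrite (_ : 2 = 1 + 1) //; apply: le_ln1Dx; lra.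
  lra.
apply: (@le_trans _ _ (2 * L / d)); first by rewrite ler_pM2r ?invr_gt0.
rewrite mulrA ler_pdivlMr // mulrAC ler_pdivrMr // /D.
have -> : 4 * L * P ^+ 2 * d = 2 * L * (2 * (P ^+ 2 * d)) by ring.
by rewrite ler_pM2l ?mulr_gt0 //; lra.
Qed.

(** After differencing the frequencies are the even multiples of b. Those not
    divisible by q contribute P log P by [sum_dint_inv], which is applicable
    because a/q is a Dirichlet approximation of order 4 P. *)
Lemma weyl_bound_sqr (b P L : K) (n c : nat) :
  0 <= b -> 1 <= P -> n%:R <= P -> 1 <= L -> 1 + ln P <= L ->
  exists a q : nat, [/\ (0 < q)%N, coprime a q &
    cabs (\sum_(0 <= i < n) e (b * (c + i)%N%:R ^+ 2)) ^+ 2 <=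
    576 * L * (P + P ^+ 2 / (q%:R + P ^+ 2 * `|q%:R * b - a%:R|))].
Proof.
move=> b0 P1 nP L1 LP; have P0 : 0 < P by lra.
pose N := (Num.truncn (4 * P)).+1.
have P40 : 0 <= 4 * P by lra.
have /andP[N1 N2] := truncn_itv P40; rewrite -/N in N2.
have N3 : N%:R <= 5 * P by rewrite /N -natr1; lra.
have [a [q [/andP[q0 qN] cop close]]] := dirichlet_approximation b0 (isT : (0 < N)%N).
exists a, q; split => //.
have Q0 : 0 < q%:R :> K by rewrite ltr0n.
set d := `|q%:R * b - a%:R|; have d0 : 0 <= d by exact: normr_ge0.
pose J := (2 * n)%N.
have JP : J%:R <= 2 * P by rewrite natrM ler_pM2l.
have hd : d <= (4 * P)^-1.
  apply: ltW; apply: lt_le_trans close _; rewrite lef_pV2 ?posrE //; lra.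
have hJ : J%:R * d <= 1 / 2.
  apply: le_trans (ler_pM _ _ JP hd) _ => //.
  by rewrite le_eqVlt; apply/orP; left; apply/eqP; field; rewrite gt_eqF.
apply: le_trans (weyl_differencing b c P0 nP) _.
have D0 : 0 < q%:R + P ^+ 2 * d by rewrite ltr_pwDl // mulr_ge0 // sqr_ge0.
set M := P ^+ 2 / _; have M0 : 0 <= M by rewrite divr_ge0 ?sqr_ge0 // ltW.
have Pi : 0 < P^-1 by rewrite invr_gt0.
have G0 j : 0 <= (P^-1 + dint (j%:R * b))^-1.
  by rewrite invr_ge0 addr_ge0 ?dint_ge0 // ltW.
have h1 := sum_even_le n G0.
have h2 := multiples_part q0 P1 L1 LP JP hJ; rewrite -/d -/M in h2.
have h3 : \sum_(1 <= j < J.+1 | ~~ (q %| j)%N) (P^-1 + dint (j%:R * b))^-1 <= 140 * L * P.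
  apply: (@le_trans _ _ (4 * (J + q)%N%:R * (1 + ln q%:R))); last first.
    have lq : 1 + ln (q%:R : K) <= 5 * L.
      have : ln (q%:R : K) <= ln (5 * P).
        by rewrite ler_ln ?posrE ?mulr_gt0 //; apply: le_trans N3; rewrite ler_nat.
      rewrite lnM ?posrE //.
      have : ln (5 : K) <= 4 by rewrite (_ : 5 = 1 + 4) //; first apply: le_ln1Dx; lra.
      lra.
    have -> : 140 * L * P = 4 * (7 * P) * (5 * L) by ring.
    apply: ler_pM => //; first by rewrite addr_ge0 ?ln_ge0 // ler1n.
    rewrite ler_pM2l // natrD; have : q%:R <= N%:R :> K by rewrite ler_nat.
    lra.
  apply: le_trans (sum_dint_inv q0 cop hJ).
  rewrite [leRHS]big_mkcond [leRHS]big_ltn // dvdn0 /= add0r -big_mkcond /=.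
  rewrite big_nat_cond [leRHS]big_nat_cond; apply: ler_sum => j /andP[/andP[_ jJ] nd].
  have g1 := dint_frac_ge_inv K q0 cop nd; have g2 := dint_perturb q0 cop hJ jJ nd.
  have g3 : 0 < (q%:R : K)^-1 by rewrite invr_gt0.
  have g4 : 0 < dint (j%:R * b) by lra.
  by rewrite lef_pV2 ?posrE //; lra.
have h4 : \sum_(1 <= j < J.+1) (P^-1 + dint (j%:R * b))^-1 <= 140 * L * P + 4 * L * M.
  by rewrite (bigID (fun j => (q %| j)%N)) /= addrC; apply: lerD.
have h5 : P <= L * P by rewrite ler_peMl // ltW.
have h6 : 0 <= L * M by rewrite mulr_ge0 //; lra.
rewrite -/J in h1; have -> : 576 * L * (P + M) = 576 * (L * P) + 576 * (L * M) by ring.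
have h7 : 140 * L * P + 4 * L * M = 140 * (L * P) + 4 * (L * M) by ring.
rewrite h7 in h4; move: h1 h4 h5 h6; set A := \sum_(_ <= _ < _) _;
  set B := \sum_(_ <= _ < _) _.
set LP' := L * P; set LM := L * M; lra.
Qed.

(** As P >= H, the square root of the diagonal term P is at most P / sqrt H:
    either the sum is small, or b has a good rational approximation. *)
Lemma weyl_bound (b P H L : K) (n c : nat) :
  0 <= b -> n%:R <= P -> 0 < H <= P -> 1 <= L -> 1 + ln P <= L ->
  exists a q : nat, [/\ (0 < q)%N, coprime a q &
    cabs (\sum_(0 <= i < n) e (b * (c + i)%N%:R ^+ 2)) <=
    24 * L * P * (isqrt H + isqrt (q%:R + P ^+ 2 * `|q%:R * b - a%:R|))].
Proof.
move=> b0 nP /andP[H0 HP] L1 LP; have P0 : 0 < P by lra.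
have [P1|P1] := ltrP P 1.
  have -> : n = 0%N.
    by apply/eqP; rewrite -leqn0 -ltnS -(ltr_nat K); lra.
  exists 1%N, 1%N; split => //; rewrite big_geq // cabs0.
  by rewrite !mulr_ge0 ?addr_ge0 ?isqrt_ge0 // ?ltW //; lra.
have [a [q [q0 cop h]]] := weyl_bound_sqr c b0 P1 nP L1 LP.
exists a, q; split => //.
set D := q%:R + _ in h *.
have D0 : 0 < D by rewrite ltr_pwDl ?ltr0n // mulr_ge0 ?sqr_ge0.
rewrite -(@ler_pXn2r _ 2) ?nnegrE ?cabs_ge0 //; last first.
  by rewrite !mulr_ge0 ?addr_ge0 ?isqrt_ge0 //; lra.
have E : 576 = 24 ^+ 2 :> K by ring.
have : 0 < 24 :> K by rewrite ltr0n.
rewrite E in h; move: h; move: (24 : K) => k h k0.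
apply: le_trans h _.
have i1 := isqrt_ge0 H; have i2 := isqrt_ge0 D.
apply: (@le_trans _ _ (k ^+ 2 * L ^+ 2 * P ^+ 2 * (H^-1 + D^-1))).
  have -> : k ^+ 2 * L ^+ 2 * P ^+ 2 * (H^-1 + D^-1)
    = k ^+ 2 * (L * (L * (P * (P / H)) + L * (P ^+ 2 / D))) by ring.
  have L0 : 0 < L by apply: lt_le_trans L1.
  have k20 : 0 < k ^+ 2 by rewrite exprn_gt0.
  rewrite -[leLHS]mulrA ler_pM2l // ler_pM2l //.
  have M0 : 0 <= P ^+ 2 / D by rewrite divr_ge0 ?sqr_ge0 // ltW.
  have : P ^+ 2 / D <= L * (P ^+ 2 / D) by rewrite ler_peMl.
  have PH : 1 <= P / H by rewrite ler_pdivlMr // mul1r.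
  have : P * 1 <= P * (P / H) by rewrite ler_pM2l.
  have : P * (P / H) <= L * (P * (P / H)) by rewrite ler_peMl // mulr_ge0 //; lra.
  lra.
have -> : (k * L * P * (isqrt H + isqrt D)) ^+ 2 =
   k ^+ 2 * L ^+ 2 * P ^+ 2 * (isqrt H ^+ 2 + isqrt D ^+ 2 + 2 * (isqrt H
     * isqrt D)) by ring.
rewrite (isqrt_sqr (ltW H0)) (isqrt_sqr (ltW D0)).
rewrite ler_wpM2l //; first by rewrite mulr_ge0 ?sqr_ge0 // mulr_ge0 ?sqr_ge0.
by rewrite lerDl !mulr_ge0.
Qed.

End WeylBound.

(** * Descent from approximations of s^2 b to one of b *)

Section Descent.
Variable K : realType.

(** The s with t | s^2 are closed under gcd, hence are the multiples of the
    least positive one, and this h satisfies h >= sqrt t. *)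
Lemma min_root_dvd (t : nat) : (0 < t)%N ->
  exists h : nat, [/\ (0 < h)%N, (t <= h ^ 2)%N &
    forall s : nat, (t %| s ^ 2)%N -> (h %| s)%N].
Proof.
move=> t0; have ex : exists h, (0 < h)%N && (t %| h ^ 2)%N.
  by exists t; rewrite t0 dvdn_exp.
case: (ex_minnP ex) => h /andP[h0 th] hmin.
exists h; split => //; first by rewrite dvdn_leq // expn_gt0 h0.
move=> s ts; have g0 : (0 < gcdn h s)%N by rewrite gcdn_gt0 h0.
have tg : (t %| gcdn h s ^ 2)%N.
  pose h' := (h %/ gcdn h s)%N; pose s' := (s %/ gcdn h s)%N.
  have Eh : h = (gcdn h s * h')%N by rewrite mulnC divnK // dvdn_gcdl.
  have Es : s = (gcdn h s * s')%N by rewrite mulnC divnK // dvdn_gcdr.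
  have cop : coprime h' s'.
    by rewrite /coprime -(eqn_pmul2l g0) muln_gcdr -Eh -Es muln1.
  have : (t %| gcdn (h ^ 2) (s ^ 2))%N by rewrite dvdn_gcd th.
  rewrite {1}Eh {2}Es !expnMn -muln_gcdr.
  have /eqP -> : coprime (h' ^ 2) (s' ^ 2) by rewrite coprimeXl // coprimeXr.
  by rewrite muln1.
have := hmin (gcdn h s); rewrite g0 tg => /(_ isT) hg.
have : (gcdn h s == h) by rewrite eqn_leq hg dvdn_leq // dvdn_gcdl.
by move/eqP/gcdn_idPl.
Qed.

Lemma count_square_multiples (t m : nat) : (0 < t)%N ->
  Num.sqrt (t%:R : K) * \sum_(1 <= s < m.+1 | (t %| s ^ 2)%N) 1 <= m%:R.
Proof.
move=> t0; have [h [h0 th hs]] := min_root_dvd t0.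
have H0 : 0 < h%:R :> K by rewrite ltr0n.
apply: (@le_trans _ _ (h%:R * (m %/ h)%N%:R));
  last by rewrite -natrM ler_nat mulnC leq_divM.
apply: ler_pM; rewrite ?sqrtr_ge0 ?sumr_ge0 //.
  by rewrite -ler_sqr ?nnegrE ?sqrtr_ge0 ?(ltW H0) // sqr_sqrtr // -natrX ler_nat.
rewrite divn_count_dvd natr_sum big_mkcond; apply: ler_sum => s _.
by case: ifP => // /hs ->.
Qed.

(** The hypothesis says a / q = s^2 b / p; reducing the right-hand side cancels
    a divisor t of p, and t | s^2 because b is prime to p. *)
Lemma fraction_descent (a q b p s : nat) :
  (0 < q)%N -> coprime a q -> (0 < p)%N -> coprime b p ->
  (p * a = q * s ^ 2 * b)%N ->
  exists t : nat, [/\ (0 < t)%N, p = (q * t)%N, (t %| s ^ 2)%N & (t * a = s ^ 2 * b)%N].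
Proof.
move=> q0 caq p0 cbp E.
have qp : (q %| p)%N.
  by rewrite -(@Gauss_dvdl _ _ a) 1?coprime_sym // E -mulnA dvdn_mulr.
have Ep : p = (q * (p %/ q))%N by rewrite mulnC divnK.
move: E; set t := (p %/ q)%N in Ep *;
  rewrite {1}Ep -[(q * t * a)%N]mulnA -[(q * _ * b)%N]mulnA => /eqP.
rewrite eqn_pmul2l // => /eqP E.
have t0 : (0 < t)%N by move: p0; rewrite Ep muln_gt0 => /andP[].
exists t; split => //; rewrite -(@Gauss_dvdl _ (s ^ 2) b) -?E ?dvdn_mulr //.
by rewrite coprime_sym; apply: coprime_dvdr cbp; rewrite Ep dvdn_mull.
Qed.

Lemma nat_eq_of_close (m n : nat) : `|m%:R - n%:R : K| < 1 -> m = n.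
Proof.
rewrite -[m%:R]/((Posz m)%:~R) -[n%:R]/((Posz n)%:~R) -intrB -intr_norm.
rewrite (ltr_int K _ 1) => h; apply/eqP.
by rewrite -(eqr_nat int) -subr_eq0 -normr_le0 -ltzD1 add0r !natz.
Qed.

Lemma isqrt_div (D : K) (t : nat) : (0 < t)%N -> 0 <= D ->
  isqrt (D / t%:R) = Num.sqrt t%:R * isqrt D.
Proof. by move=> t0 D0; rewrite /isqrt sqrtrM // sqrtrV // invfM invrK mulrC. Qed.

(** The parameter that controls a quadratic Weyl sum of length V and frequency
    b near a/q: the sum has size about V over the square root of it. *)
Definition approx_size (V b : K) (a q : nat) : K := q%:R + V ^+ 2 * `|q%:R * b - a%:R|.

Lemma approx_size_gt0 V b a q : (0 < q)%N -> 0 < approx_size V b a q.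
Proof. by move=> q0; rewrite /approx_size ltr_pwDl ?ltr0n // mulr_ge0 ?sqr_ge0. Qed.

(** If s^2 b has a good approximation a/q (approximation size below H), then
    a/q and s^2 c/p differ by less than 1/(p q), so they are equal. The
    hypothesis relating H, Y and V is exactly what this needs: one half of the
    error comes from a/q, the other from c/p. *)
Lemma approx_descent (b V Y H : K) (a q c p s : nat) :
  0 < V -> 0 < Y -> 0 < H ->
  H * (1 + 8 * H * Y ^+ 2) * (4 * Y ^+ 2) / V ^+ 2 <= 1 / 2 ->
  p%:R <= 1 + 8 * H * Y ^+ 2 -> `|p%:R * b - c%:R| * (8 * H * Y ^+ 2) < 1 ->
  (0 < q)%N -> coprime a q -> (0 < p)%N -> coprime c p ->
  (0 < s)%N -> s%:R <= 2 * Y ->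
  approx_size (V / s%:R) (s%:R ^+ 2 * b) a q < H ->
  exists t : nat, [/\ (0 < t)%N, (t %| p)%N, (t %| s ^ 2)%N &
    approx_size (V / s%:R) (s%:R ^+ 2 * b) a q = approx_size V b c p / t%:R].
Proof.
move=> V0 Y0 H0 cond pN close q0 caq p0 ccp s0 sY bad.
have S0 : 0 < s%:R :> K by rewrite ltr0n.
have Q0 : 0 < q%:R :> K by rewrite ltr0n.
have P0 : 0 < p%:R :> K by rewrite ltr0n.
have V2 : 0 < V ^+ 2 by rewrite exprn_gt0.
have Y2 : 0 < Y ^+ 2 by rewrite exprn_gt0.
have S2 : 0 < s%:R ^+ 2 :> K by rewrite exprn_gt0.
have S2Y : s%:R ^+ 2 <= 4 * Y ^+ 2.
  have -> : 4 * Y ^+ 2 = (2 * Y) ^+ 2 by ring.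
  by rewrite ler_sqr ?nnegrE ?(ltW S0) ?mulr_ge0 ?(ltW Y0).
have VS2 : 0 < (V / s%:R) ^+ 2 by rewrite exprn_gt0 // divr_gt0.
set x : K := `|p%:R * b - c%:R| in close *.
set d : K := `|q%:R * (s%:R ^+ 2 * b) - a%:R|.
have x0 : 0 <= x by exact: normr_ge0.
have qH : q%:R < H.
  by apply: le_lt_trans bad; rewrite lerDl mulr_ge0 ?sqr_ge0.
have dH : (V / s%:R) ^+ 2 * d < H.
  by apply: le_lt_trans bad; rewrite lerDr ltW.
have E : (p * a = q * s ^ 2 * c)%N.
  apply: nat_eq_of_close.
  have -> : (p * a)%N%:R - (q * s ^ 2 * c)%N%:R =
     q%:R * s%:R ^+ 2 * (p%:R * b - c%:R) - p%:R * (q%:R * (s%:R ^+ 2 * b) - a%:R) :> K.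
    by rewrite !natrM; ring.
  apply: le_lt_trans (ler_normB _ _) _; rewrite normrM [X in _ + X]normrM -/x -/d.
  rewrite (gtr0_norm (mulr_gt0 Q0 S2)) (gtr0_norm P0).
  have h1 : q%:R * s%:R ^+ 2 * x <= H * (4 * Y ^+ 2) * x.
    by rewrite ler_wpM2r // ler_pM // ltW.
  have h2 : p%:R * d <= 1 / 2.
    apply: le_trans cond.
    have d1 : d <= H * (4 * Y ^+ 2) / V ^+ 2.
      rewrite ler_pdivlMr //.
      have : d * V ^+ 2 <= H * s%:R ^+ 2.
        rewrite -ler_pdivrMr //; apply: ltW; move: dH.
        by rewrite exprMn exprVn [_ * d]mulrC mulrA.
      by move/le_trans; apply; rewrite ler_pM2l.
    have : p%:R * d <= (1 + 8 * H * Y ^+ 2) * (H * (4 * Y ^+ 2) / V ^+ 2).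
      by apply: ler_pM => //; exact: normr_ge0.
    by move/le_trans; apply; rewrite le_eqVlt; apply/orP; left; apply/eqP; ring.
  have h3 : H * (4 * Y ^+ 2) * x = x * (8 * H * Y ^+ 2) / 2 by field.
  rewrite h3 in h1; lra.
have [t [t0 Ep ts Et]] := fraction_descent q0 caq p0 ccp E.
exists t; split => //; first by rewrite Ep dvdn_mull.
have T0 : 0 < t%:R :> K by rewrite ltr0n.
apply: (@mulIf _ t%:R); first by rewrite gt_eqF.
have Ex : s%:R ^+ 2 * x = t%:R * d.
  rewrite -[s%:R ^+ 2](gtr0_norm S2) -[t%:R](gtr0_norm T0) -!normrM; congr `|_|.
  have : (t * a)%:R = (s ^ 2 * c)%:R :> K by rewrite Et.
  rewrite !natrM Ep => E2.
  have -> : t%:R * (q%:R * (s%:R ^+ 2 * b) - a%:R)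
    = t%:R * q%:R * s%:R ^+ 2 * b - t%:R * a%:R by ring.
  by rewrite E2 natrM; ring.
rewrite divfK ?gt_eqF // /approx_size -/d -/x mulrDl [in RHS]Ep natrM -mulrA; congr (_ + _).
by rewrite [d * _]mulrC -Ex; field; rewrite gt_eqF.
Qed.

(** The sizes for the good s are D / t with t | p and t | s^2, where D is the
    size for b itself. Only 2 Y / sqrt t of the s are compatible with a given t,
    which offsets the gain sqrt t, so each divisor t of p costs 2 Y. *)
Lemma descent_sum (b V Y H : K) (a q : nat -> nat) :
  0 <= b -> 0 < V -> 0 < Y -> 0 < H ->
  H * (1 + 8 * H * Y ^+ 2) * (4 * Y ^+ 2) / V ^+ 2 <= 1 / 2 ->
  (forall s, (0 < s)%N -> dyadic Y s -> (0 < q s)%N /\ coprime (a s) (q s)) ->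
  exists c p : nat, [/\ (0 < p)%N, coprime c p, p%:R <= 1 + 8 * H * Y ^+ 2 &
    \sum_(1 <= s < (Num.truncn (2 * Y)).+1 | dyadic Y s)
       isqrt (approx_size (V / s%:R) (s%:R ^+ 2 * b) (a s) (q s)) <=
    2 * Y * (isqrt H + (size (divisors p))%:R * isqrt (approx_size V b c p))].
Proof.
move=> b0 V0 Y0 H0 cond hq.
have Y2 : 0 < Y ^+ 2 by rewrite exprn_gt0.
have HY : 0 <= 8 * H * Y ^+ 2 by rewrite !mulr_ge0 // ltW.
pose N := (Num.truncn (8 * H * Y ^+ 2)).+1.
have /andP[N1 N2] := truncn_itv HY; rewrite -/N in N2.
have [c [p [/andP[p0 pN] cop close]]] := dirichlet_approximation b0 (isT : (0 < N)%N).
have pH : p%:R <= 1 + 8 * H * Y ^+ 2.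
  apply: (@le_trans _ _ N%:R); first by rewrite ler_nat.
  by rewrite /N -natr1; lra.
exists c, p; split => //.
have close' : `|p%:R * b - c%:R| * (8 * H * Y ^+ 2) < 1.
  apply: (@le_lt_trans _ _ (`|p%:R * b - c%:R| * N%:R)); first by rewrite ler_wpM2l // ltW.
  by rewrite -ltr_pdivlMr ?ltr0n // div1r.
set D := approx_size V b c p; have D0 : 0 < D by exact: approx_size_gt0.
pose m := Num.truncn (2 * Y).
have mY : m%:R <= 2 * Y by rewrite truncn_le mulr_ge0 // ltW.
have i1 := isqrt_ge0 H; have i2 := isqrt_ge0 D.
apply: (@le_trans _ _ (\sum_(1 <= s < m.+1)
   (isqrt H + \sum_(t <- divisors p | (t %| s ^ 2)%N) Num.sqrt t%:R * isqrt D))).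
  rewrite big_mkcond big_nat_cond [leRHS]big_nat_cond;
    apply: ler_sum => s /andP[/andP[s0 sm] _].
  have nn : 0 <= \sum_(t <- divisors p | (t %| s ^ 2)%N) Num.sqrt t%:R * isqrt D.
    by rewrite sumr_ge0 // => t _; rewrite mulr_ge0 // sqrtr_ge0.
  case: ifP => [dy|_]; last by rewrite addr_ge0.
  have [q0 caq] := hq s s0 dy.
  set Ds := approx_size _ _ _ _.
  have [h|h] := lerP H Ds.
    by apply: (@le_trans _ _ (isqrt H)); [exact: isqrt_le | rewrite lerDl].
  have sY : s%:R <= 2 * Y by case/andP: dy.
  have [t [t0 tp ts E]] := approx_descent V0 Y0 H0 cond pH close' q0 caq p0 cop s0 sY h.
  rewrite /Ds E isqrt_div // ?(ltW D0) //.
  have tm : t \in divisors p by rewrite -dvdn_divisors.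
  rewrite big_mkcond (bigD1_seq t) ?divisors_uniq //= ts addrCA lerDl.
  rewrite addr_ge0 // sumr_ge0 // => u _.
  by case: ifP => // _; rewrite mulr_ge0 // sqrtr_ge0.
rewrite big_split /= mulrDr; apply: lerD.
  by rewrite sumr_const_nat subn1 -[_ *+ _]mulr_natl; apply: ler_wpM2r.
rewrite (exchange_big_dep xpredT) //=.
apply: (@le_trans _ _ (\sum_(t <- divisors p) (2 * Y) * isqrt D)); last first.
  rewrite big_const_seq count_predT iter_addr_0 -mulr_natr le_eqVlt; apply/orP; left;
    apply/eqP; ring.
rewrite big_seq [leRHS]big_seq; apply: ler_sum => t.
rewrite -dvdn_divisors // => tp; have t0 := dvdn_gt0 p0 tp.
apply: (@le_trans _ _ (m%:R * isqrt D)); last by rewrite ler_wpM2r.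
apply: le_trans (ler_wpM2r i2 (count_square_multiples m t0)).
rewrite mulr_sumr mulr_suml le_eqVlt; apply/orP; left; apply/eqP.
by apply: eq_bigr => s _; rewrite mulr1.
Qed.
End Descent.

(** * Coincidences among the numbers q r^2 alpha modulo 1 *)

Section LargeRange.
Variable K : realType.

(** Counting through pairs: c^2 = c + 2 (number of pairs), and c is absorbed
    by the square at the cost of the constant 1. *)
Lemma sqr_count_le (M : nat) (x : 'I_M -> bool) :
  (\sum_(i < M) (x i)%:R : K) ^+ 2 <=
  1 + 4 * \sum_(i < M) \sum_(j < M) ((i < j)%N && x i && x j)%:R.
Proof.
set c := \sum_(i < M) _; set off := \sum_(i < M) \sum_(j < M) _.
have E : c ^+ 2 = c + 2 * off.
  have -> : c ^+ 2 = \sum_(i < M) \sum_(j < M) (x i && x j)%:R.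
    rewrite expr2 mulr_suml; apply: eq_bigr => i _; rewrite mulr_sumr.
    by apply: eq_bigr => j _; rewrite -natrM mulnb.
  have -> : 2 * off = off + \sum_(i < M) \sum_(j < M) ((j < i)%N && x j && x i)%:R.
    by rewrite exchange_big /= mulr_natl mulr2n.
  have -> : c = \sum_(i < M) \sum_(j < M) ((i == j) && x i)%:R.
    apply: eq_bigr => i _; rewrite (bigD1 i) //= eqxx big1 ?addr0 // => j.
    by rewrite eq_sym => /negbTE ->.
  rewrite -!big_split /=; apply: eq_bigr => i _; rewrite -!big_split /=.
  apply: eq_bigr => j _; rewrite -(inj_eq val_inj) /=.
  case: (ltngtP i j) => [_|_|/val_inj ->]; rewrite /= ?add0r ?addr0 //.
    by rewrite andbC.
  by rewrite andbb.
have : 0 <= (c - 1) ^+ 2 by exact: sqr_ge0.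
have -> : (c - 1) ^+ 2 = c ^+ 2 - 2 * c + 1 by ring.
lra.
Qed.

Lemma card_le_fibers (T : finType) (S : pred T) (f : T -> nat) (P : pred nat) (N : nat)
  (m : K) :
  (forall t, S t -> P (f t) /\ (0 < f t <= N)%N) ->
  (forall n, (0 < n <= N)%N -> (#|[pred t | S t & f t == n]|)%:R <= m) ->
  \sum_(t | S t) (1 : K) <= \sum_(1 <= n < N.+1 | P n) m.
Proof.
move=> hS hm.
apply: (@le_trans _ _ (\sum_(t | S t) \sum_(1 <= n < N.+1 | P n) (f t == n)%:R)).
  apply: ler_sum => t /hS [Pt /andP[t0 tN]].
  rewrite big_mkcond (bigD1_seq (f t)) ?iota_uniq ?mem_index_iota ?t0 //= Pt eqxx.
  by rewrite lerDl sumr_ge0 // => n _; case: ifP.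
rewrite exchange_big /= big_nat_cond [leRHS]big_nat_cond.
apply: ler_sum => n /andP[nN _]; apply: le_trans (hm n nN).
rewrite -sum1_card natr_sum big_mkcond [leRHS]big_mkcond.
by apply: ler_sum => t _; rewrite !inE; case: (S t); case: eqP.
Qed.

(** From n = u (j - i) (j + i) the two divisors j - i and j + i of n determine
    i, j and u. *)
Lemma fiber_divisors (B M n : nat) (S : pred ('I_B * 'I_M * 'I_M)) : (0 < n)%N ->
  (forall t, S t -> (t.1.2 < t.2)%N) ->
  (#|[pred t | S t & t.1.1 * ((t.2 - t.1.2) * (t.2 + t.1.2)) == n]| <=
    size (divisors n) ^ 2)%N.
Proof.
move=> n0 hS; set F := [pred t | _ & _].
pose g (t : 'I_B * 'I_M * 'I_M) := ((t.2 - t.1.2)%N, (t.2 + t.1.2)%N).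
have injg : {in F &, injective g}.
  move=> [[u i] j] [[u' i'] j'];
    rewrite !inE /= => /andP[/hS /= ij /eqP E] /andP[/hS /= ij' /eqP E'] [e1 e2].
  have ei : i = i' by apply/val_inj => /=; lia.
  have ej : j = j' by apply/val_inj => /=; lia.
  rewrite -ei -ej in E' ij'; rewrite ei ej; congr (_, _, _); apply/val_inj => /=.
  move/eqP: E'; rewrite -E eqn_pmul2r; first by move/eqP.
  by rewrite muln_gt0 subn_gt0 ij addn_gt0 (leq_ltn_trans _ ij) ?orbT.
rewrite cardE -(size_map g) -mulnn -(size_allpairs pair).
apply: uniq_leq_size.
  by rewrite map_inj_in_uniq ?enum_uniq // => x y; rewrite !mem_enum; exact: injg.
move=> y /mapP [[[u i] j]]; rewrite mem_enum inE /= => /andP[_ /eqP E] ->.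
apply: allpairs_f; rewrite -dvdn_divisors //= -E mulnCA.
  by rewrite dvdn_mulr.
by rewrite mulnA dvdn_mull.
Qed.

(** Each r of approximation size below H has a denominator u = q r <= H with
    ||u r^2 al|| <= d, and contributes at most u^(-1/2). By Cauchy's inequality
    over u it is enough to count, for each u, pairs i < j of such r. The
    difference n = u (j^2 - i^2) then satisfies ||n al|| <= 2 d and
    n <= 4 H R^2, a given n comes from few pairs, and such n are counted with
    the approximation a0/q0 of al. The Cauchy weight k is left free. *)
Lemma large_sum (al V R H k L tau : K) (a0 q0 : nat) (a q : nat -> nat) :
  0 < V -> 0 < R -> 0 < H -> 0 < k -> 1 <= L -> 1 + ln H <= L ->
  (0 < q0)%N -> coprime a0 q0 ->
  4 * H * R ^+ 2 * `|q0%:R * al - a0%:R| <= 1 / 2 ->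
  (forall n : nat, (0 < n)%N -> n%:R <= 4 * H * R ^+ 2 -> (size (divisors n))%:R <= tau) ->
  (forall r, (0 < r)%N -> dyadic R r -> (0 < q r)%N) ->
  \sum_(1 <= r < (Num.truncn (2 * R)).+1 | dyadic R r)
     isqrt (approx_size (V / r%:R) (r%:R ^+ 2 * al) (a r) (q r)) <=
  2 * R * isqrt H + k * L + (H + 4 * (tau ^+ 2 * (4 * H * R ^+ 2 / q0%:R +
     2 * (4 * H * R ^+ 2 / V ^+ 2) * (4 * (4 * H * R ^+ 2 + q0%:R) * (1 + ln q0%:R))))) / k.
Proof.
move=> V0 R0 H0 k0 L1 HL q00 cop0 close htau hq.
have Q0 : 0 < q0%:R :> K by rewrite ltr0n.
set d := 4 * H * R ^+ 2 / V ^+ 2.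
have R2 : 0 < R ^+ 2 by rewrite exprn_gt0.
have V2 : 0 < V ^+ 2 by rewrite exprn_gt0.
have HR : 0 < 4 * H * R ^+ 2 by rewrite !mulr_gt0.
have d0 : 0 < d by rewrite divr_gt0.
pose M := (Num.truncn (2 * R)).+1; pose B := (Num.truncn H).+1.
have MR : (Num.truncn (2 * R))%:R <= 2 * R by rewrite truncn_le mulr_ge0 // ltW.
have BH : (Num.truncn H)%:R <= H by rewrite truncn_le ltW.
pose x (u r : nat) := [&& (0 < u)%N, (0 < r)%N, dyadic R r & dint ((u * r ^ 2)%N%:R
  * al) <= d].
pose c (u : nat) : K := \sum_(r < M) (x u r)%:R.
set X := tau ^+ 2 * _.
(* r is charged to u = q r when its size is below H, to isqrt H otherwise *)
have step1 : \sum_(1 <= r < M | dyadic R r)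
     isqrt (approx_size (V / r%:R) (r%:R ^+ 2 * al) (a r) (q r)) <=
     2 * R * isqrt H + \sum_(1 <= u < B) isqrt u%:R * c u.
  apply: (@le_trans _ _ (\sum_(1 <= r < M) (isqrt H + \sum_(1
    <= u < B) isqrt u%:R * (x u r)%:R))).
    rewrite big_mkcond big_nat_cond [leRHS]big_nat_cond;
      apply: ler_sum => r /andP[/andP[r0 rM] _].
    have nn : 0 <= \sum_(1 <= u < B) isqrt u%:R * (x u r)%:R :> K.
      by rewrite sumr_ge0 // => u _; rewrite mulr_ge0 // isqrt_ge0.
    have i1 := isqrt_ge0 H.
    case: ifP => [dy|_]; last by rewrite addr_ge0.
    set D := approx_size _ _ _ _.
    have [h|h] := lerP H D.
      by apply: (@le_trans _ _ (isqrt H)); [exact: isqrt_le | rewrite lerDl].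
    have qr0 := hq r r0 dy; have QR0 : 0 < (q r)%:R :> K by rewrite ltr0n.
    have RR : 0 < r%:R :> K by rewrite ltr0n.
    have rY : r%:R <= 2 * R by case/andP: dy.
    set y := `|(q r)%:R * (r%:R ^+ 2 * al) - (a r)%:R|.
    have y0 : 0 <= y by exact: normr_ge0.
    have VR : 0 < (V / r%:R) ^+ 2 by rewrite exprn_gt0 // divr_gt0.
    have qD : (q r)%:R <= D by rewrite lerDl mulr_ge0 // ltW.
    have yD : (V / r%:R) ^+ 2 * y <= H.
      by apply: le_trans (ltW h); rewrite lerDr ltW.
    have xr : x (q r) r.
      rewrite /x qr0 r0 dy /=.
      apply: (@le_trans _ _ y).
        by have := dint_leN ((q r * r ^ 2)%N%:R * al) (a r); rewrite natrM natrX -mulrA.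
      rewrite /d ler_pdivlMr //.
      have : y * V ^+ 2 <= H * r%:R ^+ 2.
        rewrite -ler_pdivrMr ?exprn_gt0 //; move: yD.
        by rewrite exprMn exprVn [_ * y]mulrC mulrA.
      move/le_trans; apply; rewrite mulrAC [leRHS]mulrC ler_pM2l //.
      have -> : 4 * R ^+ 2 = (2 * R) ^+ 2 by ring.
      by rewrite ler_sqr ?nnegrE ?(ltW RR) ?mulr_ge0 ?(ltW R0).
    apply: (@le_trans _ _ (isqrt (q r)%:R)); first exact: isqrt_le.
    have qB : (q r < B)%N.
      by rewrite /B ltnS truncn_ge_nat ?(ltW H0) //; apply: le_trans qD (ltW h).
    rewrite (bigD1_seq (q r)) ?iota_uniq ?mem_index_iota ?qr0 //= xr mulr1 addrCA lerDl.
    by rewrite addr_ge0 // sumr_ge0 // => u _; rewrite mulr_ge0 // isqrt_ge0.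
  rewrite big_split /=; apply: lerD.
    by rewrite sumr_const_nat subn1 -[_ *+ _]mulr_natl; apply: ler_wpM2r;
      rewrite ?isqrt_ge0.
  rewrite exchange_big /=; apply: ler_sum => u _.
  rewrite -mulr_sumr ler_wpM2l ?isqrt_ge0 // /c -(big_mkord xpredT (fun r => (x u
    r)%:R)) /=.
  by rewrite [leRHS]big_ltn //= lerDr.
apply: le_trans step1 _; rewrite -addrA lerD2l.
(* Cauchy's inequality in the form x y <= k x^2 + y^2 / k *)
have step2 : \sum_(1 <= u < B) isqrt u%:R * c u <=
    k * (\sum_(1 <= u < B) u%:R^-1) + (\sum_(1 <= u < B) c u ^+ 2) / k.
  rewrite mulr_sumr mulr_suml -big_split /=; apply: ler_sum => u _.
  set w := isqrt _; have -> : u%:R^-1 = w ^+ 2 by rewrite isqrt_sqr.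
  have : 0 <= (k * w - c u) ^+ 2 / k by rewrite divr_ge0 ?sqr_ge0 // ltW.
  have -> : (k * w - c u) ^+ 2 / k = k * w ^+ 2 + c u ^+ 2 / k - 2 * (w * c u).
    by field; rewrite gt_eqF.
  have : 0 <= w * c u by rewrite mulr_ge0 ?isqrt_ge0 ?sumr_ge0.
  by set A := w * c u; set A1 := k * _; set A2 := _ / k; lra.
apply: le_trans step2 _; apply: lerD.
  rewrite ler_pM2l //.
  have [B0|B0] := posnP (Num.truncn H).
    by rewrite /B B0 big_geq //; exact: le_trans L1.
  apply: le_trans (harmonic_le K B0) _; apply: le_trans HL; rewrite lerD2l.
  by rewrite ler_ln ?posrE ?ltr0n.
rewrite ler_pM2r ?invr_gt0 //.
pose off (u : nat) : K := \sum_(i < M) \sum_(j < M) ((i < j)%N && x u i && x u j)%:R.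
apply: (@le_trans _ _ (\sum_(1 <= u < B) (1 + 4 * off u))).
  by apply: ler_sum => u _; exact: sqr_count_le.
rewrite big_split /=; apply: lerD.
  by rewrite sumr_const_nat subn1.
rewrite -mulr_sumr ler_pM2l //.
pose S (t : 'I_B * 'I_M * 'I_M) := [&& (t.1.2 < t.2)%N, x t.1.1 t.1.2 & x t.1.1 t.2].
pose f (t : 'I_B * 'I_M * 'I_M) := (t.1.1 * ((t.2 - t.1.2) * (t.2 + t.1.2)))%N.
apply: (@le_trans _ _ (\sum_(t | S t) 1)).
  apply: (@le_trans _ _ (\sum_(u < B) off u)).
    by rewrite -(big_mkord xpredT off) /= [leRHS]big_ltn //= lerDr !sumr_ge0 // => i _;
      rewrite sumr_ge0.
  rewrite le_eqVlt; apply/orP; left; apply/eqP.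
  rewrite [RHS]big_mkcond /= (pair_bigA _ (fun (u : 'I_B) (i : 'I_M) => \sum_(j < M)
    ((i < j)%N && x u i && x u j)%:R)) /=.
  rewrite (pair_bigA _ (fun (p : 'I_B
    * 'I_M) (j : 'I_M) => ((p.2 < j)%N && x p.1 p.2 && x p.1 j)%:R)) /=.
  by apply: eq_bigr => t _; rewrite /S -andbA; case: (_ && _).
pose J := Num.truncn (4 * H * R ^+ 2).
have JH : J%:R <= 4 * H * R ^+ 2 by rewrite truncn_le ltW.
apply: (@le_trans _ _ (\sum_(1 <= n < J.+1 | dint (n%:R * al) <= 2 * d) tau ^+ 2)).
  apply: (card_le_fibers (f := f)).
    move=> [[u i] j] /and3P[/= ij];
      rewrite /f /= => /and4P[u0 i0 dyi xi] /and4P[_ j0 dyj xj].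
    have E : (u * ((j - i) * (j + i)) = u * j ^ 2 - u * i ^ 2)%N.
      by rewrite -mulnBr -subn_sqr.
    split.
      rewrite E natrB ?mulrBl; last by rewrite leq_mul2l leq_exp2r // (ltnW ij) orbT.
      apply: le_trans (dintB _ _) _; rewrite mulr2n mulrDl mul1r; exact: lerD.
    rewrite muln_gt0 u0 muln_gt0 subn_gt0 ij addn_gt0 j0 /=.
    rewrite truncn_ge_nat ?(ltW HR) // E.
    apply: (@le_trans _ _ (u * j ^ 2)%N%:R); first by rewrite ler_nat leq_subr.
    rewrite natrM natrX.
    have -> : 4 * H * R ^+ 2 = H * (2 * R) ^+ 2 by ring.
    apply: ler_pM => //; first by rewrite -truncn_ge_nat ?(ltW H0) // -ltnS.
    have jY : j%:R <= 2 * R by case/andP: dyj.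
    by rewrite ler_sqr ?nnegrE ?mulr_ge0 ?(ltW R0).
  move=> n /andP[n0 nJ].
  have nH : n%:R <= 4 * H * R ^+ 2 by apply: le_trans JH; rewrite ler_nat.
  have ht := htau n n0 nH; have t0 : 0 <= tau by apply: le_trans ht.
  apply: (@le_trans _ _ ((size (divisors n) ^ 2)%N%:R)).
    by rewrite ler_nat; apply: fiber_divisors => // t /and3P[].
  by rewrite natrX ler_sqr ?nnegrE.
have hJ : J%:R * `|q0%:R * al - a0%:R| <= 1 / 2.
  by apply: le_trans close; rewrite ler_wpM2r.
have d20 : 0 < 2 * d by rewrite mulr_gt0.
have lq : 0 <= ln (q0%:R : K) by rewrite ln_ge0 // ler1n.
have := count_dint_le q00 cop0 hJ d20.
rewrite (_ : \sum_(1 <= n < J.+1 | dint (n%:R * al) <= 2 * d) tau ^+ 2 =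
  tau ^+ 2 * \sum_(1 <= n < J.+1 | dint (n%:R * al) <= 2 * d) 1); last first.
  by rewrite mulr_sumr; apply: eq_bigr => n _; rewrite mulr1.
move=> h; rewrite /X ler_wpM2l ?sqr_ge0 //; apply: le_trans h _.
apply: lerD; first by rewrite ler_wpM2r // invr_ge0 ltW.
rewrite ler_pM2l // ler_wpM2r ?addr_ge0 // ler_pM2l // natrD lerD2r //.
Qed.
End LargeRange.

(** * Logarithms, divisors and dyadic intervals *)

Section Growth.
Variable K : realType.

Lemma ln_le_powR (eta : K) : 0 < eta ->
  forall x : K, 1 <= x -> 1 + ln x <= (1 + eta^-1) * x `^ eta.
Proof.
move=> e0 x x1; have x0 : 0 < x by apply: lt_le_trans x1.
have y1 : 1 <= x `^ eta by rewrite -[leLHS](powRr0 x) ler_powR // ltW.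
have := @le_ln1Dx K (x `^ eta - 1).
rewrite addrCA subrr addr0 ln_powR => h.
have {}h : eta * ln x <= x `^ eta - 1 by apply: h; lra.
have : ln x <= (x `^ eta - 1) / eta by rewrite ler_pdivlMr // mulrC.
have ei : 0 < eta^-1 by rewrite invr_gt0.
rewrite mulrBl mul1r mulrDl mul1r [eta^-1 * _]mulrC; lra.
Qed.

Lemma size_add_divisors (f : nat * nat) (ds : seq nat) :
  size (foldr PrimeDecompAux.add_divisors ds [:: f]) = (f.2.+1 * size ds)%N.
Proof.
case: f => p k /=; elim: k => [|k IH] /=; first by rewrite mul1n.
by rewrite size_merge size_cat size_map IH -mulSnr.
Qed.

Lemma size_divisors (n : nat) :
  size (divisors n) = (\prod_(p <- primes n) (logn p n).+1)%N.
Proof.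
rewrite /divisors prime_decompE.
elim: (primes n) => [|p s IH] /=; first by rewrite big_nil.
by rewrite big_cons -IH; exact: (size_add_divisors (p, logn p n)).
Qed.

Lemma prod_primes (n : nat) : (0 < n)%N -> n = (\prod_(p <- primes n) p ^ logn p n)%N.
Proof. by move=> n0; rewrite {1}(prod_prime_decomp n0) prime_decompE big_map. Qed.

(** Bernoulli's inequality for y0 ^ k. *)
Lemma exponent_bound (y0 y : K) (k : nat) : 1 < y0 -> y0 <= y ->
  k.+1%:R <= (1 + (y0 - 1)^-1) * y ^+ k.
Proof.
move=> y1 yy; have d0 : 0 < (y0 - 1)^-1 by rewrite invr_gt0; lra.
have B (m : nat) : 1 + m%:R * (y0 - 1) <= y0 ^+ m.
  elim: m => [|m IH]; first by rewrite mul0r addr0 expr0.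
  rewrite exprS -natr1.
  have : y0 * (1 + m%:R * (y0 - 1)) <= y0 * y0 ^+ m by rewrite ler_pM2l //; lra.
  have : 0 <= m%:R * (y0 - 1) ^+ 2 by rewrite mulr_ge0 // sqr_ge0.
  have -> : m%:R * (y0 - 1) ^+ 2
    = y0 * (1 + m%:R * (y0 - 1)) - (1 + (m%:R + 1) * (y0 - 1)) by ring.
  lra.
apply: (@le_trans _ _ ((1 + (y0 - 1)^-1) * (1 + k%:R * (y0 - 1)))).
  have -> : (1 + (y0 - 1)^-1) * (1 + k%:R * (y0 - 1))
    = 1 + k%:R * (y0 - 1) + (y0 - 1)^-1 + k%:R.
    by field; lra.
  have : 0 <= k%:R * (y0 - 1) by rewrite mulr_ge0 //; lra.
  rewrite -natr1; lra.
rewrite ler_pM2l; last by lra.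
by apply: le_trans (B k) _; apply: lerXn2r; rewrite ?nnegrE; lra.
Qed.

(** Compare d(n) = prod (k_p + 1) with n^eta = prod (p^eta)^k_p prime by prime:
    for p^eta >= 2 the factor of d(n) is the smaller one, and for the finitely
    many other p the quotient is bounded by C0. *)
Lemma divisor_bound (eta : K) : 0 < eta ->
  exists2 C : K, 1 <= C & forall n : nat, (0 < n)%N ->
    (size (divisors n))%:R <= C * n%:R `^ eta.
Proof.
move=> e0; pose y0 : K := 2 `^ eta.
have y01 : 1 < y0.
  have E1 : 1 = 1 `^ eta :> K by rewrite powR1.
  by rewrite [ltLHS]E1 /y0; apply: gt0_ltr_powR; rewrite ?nnegrE ?ltr1n.
pose C0 := 1 + (y0 - 1)^-1.
have C01 : 1 <= C0 by rewrite /C0 lerDl invr_ge0; lra.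
pose P0 := (Num.truncn ((2 : K) `^ eta^-1)).+1.
pose w (p : nat) := if (p < P0)%N then C0 else 1.
exists (C0 ^+ P0); first by rewrite exprn_ege1.
move=> n n0.
have powE : n%:R `^ eta = \prod_(p <- primes n) (p%:R `^ eta) ^+ logn p n :> K.
  rewrite {1}(prod_primes n0) natr_prod.
  elim: (primes n) => [|p s IH]; first by rewrite !big_nil powR1.
  rewrite !big_cons powRM ?IH ?natrX // ?exprn_ge0 //; last by rewrite prodr_ge0.
  by congr (_ * _); rewrite -powR_mulrn // -powRrM mulrC powRrM powR_mulrn ?powR_ge0.
have wbound : \prod_(p <- primes n) w p <= C0 ^+ P0.
  rewrite /w -big_mkcond /= big_const_seq iter_mulr_1 ler_weXn2l //.
  rewrite -size_filter; apply: (@leq_trans (size (iota 0 P0))); last by rewrite size_iota.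
  apply: uniq_leq_size; first by rewrite filter_uniq ?primes_uniq.
  by move=> p; rewrite mem_filter mem_iota /= add0n => /andP[].
apply: (@le_trans _ _ (\prod_(p <- primes n) w p * n%:R `^ eta)); last first.
  by rewrite ler_wpM2r // powR_ge0.
rewrite size_divisors natr_prod powE -big_split /=.
rewrite big_seq [leRHS]big_seq; apply: ler_prod => p.
rewrite mem_primes => /andP[pp _]; rewrite ler0n /=.
have p2 : 2 <= p%:R :> K by rewrite ler_nat prime_gt1.
rewrite /w; case: ltnP => hp.
  apply: exponent_bound => //; apply: ge0_ler_powR; rewrite ?nnegrE // ?ltW //.
rewrite mul1r; have : 2 <= p%:R `^ eta :> K.
  have -> : 2 = (2 `^ eta^-1) `^ eta :> K by rewrite -powRrM mulVf ?gt_eqF // powRr1.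
  apply: ge0_ler_powR; rewrite ?nnegrE ?powR_ge0 // ?ltW //.
  by apply: lt_le_trans (truncnS_gt _) _; rewrite ler_nat.
move=> h.
apply: (@le_trans _ _ (2 ^+ logn p n)); last first.
  by apply: lerXn2r; rewrite ?nnegrE ?powR_ge0.
by rewrite -natrX ler_nat ltn_expl.
Qed.

End Growth.

(** The m with X < k m <= 2 X form an interval; when it is not empty 2 X / k is
    at least 1, so its length, at most X / k + 1, is at most 3 X / k. *)
Lemma dyadic_interval (K : realType) (Y : nmodType) (X : K) (k : nat) (F : nat -> Y) :
  0 < X -> (0 < k)%N -> exists c n : nat, n%:R <= 3 * X / k%:R /\
  \sum_(1 <= m < (Num.truncn (2 * X)).+1 | dyadic X (k * m)%N) F m =
  \sum_(0 <= i < n) F (c + i)%N.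
Proof.
move=> X0 k0; have k0' : 0 < k%:R :> K by rewrite ltr0n.
pose y := X / k%:R; have y0 : 0 < y by rewrite divr_gt0.
have y20 : 0 <= 2 * y by lra.
pose m1 := (Num.truncn y).+1; pose m2 := (Num.truncn (2 * y)).+1.
exists m1, (m2 - m1)%N; split.
  have [h|h] := leqP m2 m1.
    by rewrite (eqP (h : (m2 - m1)%N == 0%N)) !mulr_ge0 ?invr_ge0 // ltW.
  have h1 : (Num.truncn (2 * y))%:R <= 2 * y by rewrite truncn_le.
  have h2 := truncnS_gt y; rewrite -natr1 in h2.
  have h3 : 1 <= 2 * y by rewrite -(truncn_gt0 (2 * y)); move: h; rewrite /m1 /m2; lia.
  rewrite /m1 /m2 subSS natrB; last by move: h; rewrite /m1 /m2; lia.
  by rewrite -mulrA -/y; lra.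
have E m : dyadic X (k * m)%N = (m1 <= m)%N && (m < m2)%N.
  rewrite /dyadic natrM; congr (_ && _).
    by rewrite /m1 truncn_lt_nat ?(ltW y0) // /y ltr_pdivrMr // mulrC.
  by rewrite /m2 ltnS (truncn_ge_nat _ y20) /y mulrA ler_pdivlMr // mulrC.
rewrite (eq_bigl _ _ E).
have m2B : (m2 <= (Num.truncn (2 * X)).+1)%N.
  rewrite /m2 ltnS le_truncn // ler_pM2l // /y ler_pdivrMr // ler_peMr ?ler1n //.
  exact: ltW.
apply: (@etrans _ _ (\sum_(m1 <= i < m2) F i)).
  by rewrite [RHS](@big_nat_widenl _ _ _ m1 1) // [RHS](big_nat_widen _ _ _ _ _ m2B).
rewrite -{1}[m1]add0n big_addn; apply: eq_bigr => i _; by rewrite addnC.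
Qed.

(** * The summations over s and over r *)

Section Assembly.
Variable K : realType.

(** The converse reading of the minor arcs, for approximations a/q with a not
    restricted to [1, q]. A fraction with a = 0 is excluded by the left end of
    the interval, and one with a > q by the right end, as Q^2 <= X^2. *)
Lemma minor_arc_approx (sigma X al : K) : 0 < sigma < 1 / 6 -> 1 <= X ->
  al \in minor_arcs sigma X ->
  0 <= al /\ forall a q : nat, (0 < q)%N -> coprime a q ->
    (X `^ sigma) ^+ 4 / 2 <= q%:R \/
    (X `^ sigma) ^+ 4 / X ^+ 2 <= `|q%:R * al - a%:R|.
Proof.
move=> /andP[s0 s6] X1; rewrite inE /minor_arcs; set x := X `^ sigma.
have X0 : 0 < X by lra.
have x1 : 1 <= x by rewrite -[leLHS](powRr0 X) ler_powR // ltW.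
have x0 : 0 < x by lra.
have E4 : X `^ (4 * sigma) = x ^+ 4 by rewrite mulrC powRrM powR_mulrn // ltW.
have x6X : x ^+ 6 <= X.
  rewrite -powR_mulrn ?(ltW x0) // -powRrM -[leRHS](powRr1 (ltW X0)) ler_powR //; lra.
rewrite E4 => -[/= ]; rewrite in_itv /= => /andP[al1 al2] nmaj.
have X20 : 0 < X ^+ 2 by rewrite exprn_gt0.
have x40 : 0 < x ^+ 4 by rewrite exprn_gt0.
have QX0 : 0 < x ^+ 4 / X ^+ 2 by rewrite divr_gt0.
split; first by lra.
move=> a q q0 cop; apply: contrapT => /not_orP[/negP]; rewrite -ltNge => hq /negP;
  rewrite -ltNge => hd.
apply: nmaj; have Q0 : 0 < q%:R :> K by rewrite ltr0n.
have Q1 : 1 <= q%:R :> K by rewrite ler1n.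
exists q => /=; first by split => //; lra.
have a0 : (0 < a)%N.
  rewrite lt0n; apply/eqP => a0; move: cop hd; rewrite a0 /coprime gcd0n => /eqP ->.
  by rewrite mul1r subr0 ger0_norm; lra.
have aq : (a <= q)%N.
  rewrite leqNgt; apply/negP => qa.
  have : q%:R + 1 <= a%:R :> K by rewrite natr1 ler_nat.
  move: hd; rewrite ltr_norml => /andP[hd _] h.
  have h1 : q%:R * al <= q%:R * (1 + x ^+ 4 / X ^+ 2) by rewrite ler_pM2l.
  have h2 : 1 < (1 + q%:R) * (x ^+ 4 / X ^+ 2) by lra.
  have h3 : (1 + q%:R) * (x ^+ 4 / X ^+ 2) <= x ^+ 4 * (x ^+ 4 / X ^+ 2).
    by rewrite ler_pM2r //; lra.
  have : x ^+ 4 * (x ^+ 4 / X ^+ 2) <= 1.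
    rewrite mulrA ler_pdivrMr // mul1r.
    have -> : x ^+ 4 * x ^+ 4 = x ^+ 8 by rewrite -exprD.
    apply: (@le_trans _ _ (x ^+ 12)); first by rewrite ler_weXn2l.
    have -> : x ^+ 12 = (x ^+ 6) ^+ 2 by rewrite -exprM.
    by rewrite ler_sqr ?nnegrE ?exprn_ge0 // ltW.
  lra.
exists a => /=; first by rewrite a0 aq.
rewrite /major_arc /= in_itv /=.
have : `|al - a%:R / q%:R| < x ^+ 4 / (q%:R * X ^+ 2).
  have -> : al - a%:R / q%:R = (q%:R * al - a%:R) / q%:R by field; rewrite gt_eqF.
  rewrite normrM normfV [`|q%:R|]gtr0_norm // ltr_pdivrMr //.
  have -> : x ^+ 4 / (q%:R * X ^+ 2) * q%:R = x ^+ 4 / X ^+ 2 by field; rewrite ?gt_eqF.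
  exact: hd.
by rewrite ltr_norml; lra.
Qed.

(** When R^2 x^2 <= X the descent applies to al itself, and on the minor arcs the
    size of the resulting approximation is at least H. *)
Lemma outer_sum_small (X x R H al tau N : K) (b p : nat -> nat) :
  1 <= X -> 1 <= x -> 0 < R -> 0 < H -> 0 <= al ->
  8 * H <= x ^+ 2 -> R ^+ 2 * x ^+ 2 <= X -> 1 <= tau -> 1 + 8 * H * R ^+ 2 <= N ->
  (forall n : nat, (0 < n)%N -> n%:R <= N -> (size (divisors n))%:R <= tau) ->
  (forall a q : nat, (0 < q)%N -> coprime a q ->
    x ^+ 4 / 2 <= q%:R \/ x ^+ 4 / X ^+ 2 <= `|q%:R * al - a%:R|) ->
  (forall r, (0 < r)%N -> dyadic R r -> (0 < p r)%N /\ coprime (b r) (p r)) ->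
  \sum_(1 <= r < (Num.truncn (2 * R)).+1 | dyadic R r)
     isqrt (approx_size (3 * X / r%:R) (r%:R ^+ 2 * al) (b r) (p r)) <=
  4 * tau * (R * isqrt H).
Proof.
move=> X1 x1 R0 H0 al0 hH small tau1 hN htau minor hp.
have X0 : 0 < X by exact: lt_le_trans X1.
have x0 : 0 < x by exact: lt_le_trans x1.
have V0 : 0 < 3 * X by exact: mulr_gt0.
have X20 : 0 < X ^+ 2 by rewrite exprn_gt0.
have x24 : x ^+ 2 <= x ^+ 4 by rewrite ler_weXn2l.
have HR0 : 0 < H * R ^+ 2 by rewrite mulr_gt0 // exprn_gt0.
have cond : H * (1 + 8 * H * R ^+ 2) * (4 * R ^+ 2) / (3 * X) ^+ 2 <= 1 / 2.
  clear minor htau hN.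
  have HRX : 8 * (H * R ^+ 2) <= X.
    have : 8 * H * R ^+ 2 <= x ^+ 2 * R ^+ 2 by rewrite ler_pM2r // exprn_gt0.
    lra.
  rewrite ler_pdivrMr ?exprn_gt0 //.
  have -> : H * (1 + 8 * H * R ^+ 2) * (4 * R ^+ 2) =
     (8 * (H * R ^+ 2)) / 2 + (8 * (H * R ^+ 2)) * (8 * (H * R ^+ 2)) / 2 by field.
  have : (8 * (H * R ^+ 2)) * (8 * (H * R ^+ 2)) <= X * X.
    by apply: ler_pM => //; rewrite mulr_ge0 // ltW.
  have : X * 1 <= X * X by rewrite ler_pM2l.
  rewrite -expr2 => h1 h2; have -> : (3 * X) ^+ 2 = 9 * X ^+ 2 by ring.
  lra.
have [c0 [p0 [p00 cop pN]]] := descent_sum al0 V0 R0 H0 cond hp.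
move/le_trans; apply.
set D := approx_size _ _ _ _.
have DH : H <= D.
  have hx : H <= x ^+ 4 / 2 by clear - hH x24 H0; lra.
  have y0 : 0 <= (3 * X) ^+ 2 * `|p0%:R * al - c0%:R| by rewrite mulr_ge0 // sqr_ge0.
  apply: le_trans hx _; rewrite /D /approx_size.
  have [h|h] := minor c0 p0 p00 cop; first by apply: le_trans h _; rewrite lerDl.
  have : x ^+ 4 <= X ^+ 2 * `|p0%:R * al - c0%:R| by rewrite mulrC -ler_pdivrMr.
  have -> : (3 * X) ^+ 2 * `|p0%:R * al - c0%:R|
    = 9 * (X ^+ 2 * `|p0%:R * al - c0%:R|) by ring.
  have : 0 <= p0%:R :> K by [].
  have : 0 <= x ^+ 4 by rewrite exprn_ge0 // ltW.
  by clear; lra.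
have iD : isqrt D <= isqrt H by exact: isqrt_le.
have dp : (size (divisors p0))%:R <= tau by apply: htau => //; apply: le_trans hN.
have h : (size (divisors p0))%:R * isqrt D <= tau * isqrt H.
  by apply: ler_pM => //; exact: isqrt_ge0.
apply: (@le_trans _ _ (2 * R * (isqrt H + tau * isqrt H))).
  by rewrite ler_pM2l ?mulr_gt0 // lerD2l.
have -> : 2 * R * (isqrt H + tau * isqrt H) = 2 * (1 + tau) * (R * isqrt H) by ring.
rewrite ler_wpM2r ?mulr_ge0 ?isqrt_ge0 ?(ltW R0) //.
by clear - tau1; lra.
Qed.

(** The four terms left by [large_sum] against k^2 for k = R / sqrt H. *)
Lemma large_range_terms (X x R H q : K) :
  0 < X -> 0 < x -> 0 < R -> 0 < H -> 0 < q ->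
  x ^+ 4 <= R ^+ 2 -> 64 * H ^+ 2 <= x ^+ 4 -> 16 * H ^+ 3 * R ^+ 2 <= 9 * X ^+ 2 ->
  x ^+ 4 / 2 <= q -> q * x ^+ 4 <= 2 * X ^+ 2 ->
  [/\ H <= R ^+ 2 / H, 4 * H * R ^+ 2 / q <= R ^+ 2 / H,
      4 * H * R ^+ 2 / (3 * X) ^+ 2 * (4 * H * R ^+ 2) <= R ^+ 2 / H &
      4 * H * R ^+ 2 / (3 * X) ^+ 2 * q <= R ^+ 2 / H].
Proof.
move=> X0 x0 R0 H0 q0 hR HH hl2 qx qX.
have R20 : 0 < R ^+ 2 by rewrite exprn_gt0.
have X20 : 0 < (3 * X) ^+ 2 by rewrite exprn_gt0 // mulr_gt0.
have E9 : (3 * X) ^+ 2 = 9 * X ^+ 2 by ring.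
split.
- rewrite ler_pdivlMr // -expr2.
  have : 0 <= H ^+ 2 by exact: sqr_ge0.
  by clear - HH hR; lra.
- rewrite ler_pdivlMr // mulrAC ler_pdivrMr //.
  have h1 : R ^+ 2 * (x ^+ 4 / 2) <= R ^+ 2 * q by rewrite ler_pM2l.
  have h2 : R ^+ 2 * (64 * H ^+ 2) <= R ^+ 2 * x ^+ 4 by rewrite ler_pM2l.
  have -> : 4 * H * R ^+ 2 * H = 4 * (R ^+ 2 * H ^+ 2) by ring.
  have : 0 <= R ^+ 2 * H ^+ 2 by rewrite mulr_ge0 ?sqr_ge0.
  by clear - h1 h2; lra.
- rewrite ler_pdivlMr // mulrAC -mulrA mulrAC ler_pdivrMr //.
  have -> : 4 * H * R ^+ 2 * (H * (4 * H * R ^+ 2))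
    = R ^+ 2 * (16 * H ^+ 3 * R ^+ 2) by ring.
  by rewrite E9 ler_pM2l.
- rewrite ler_pdivlMr // mulrAC -mulrA mulrAC ler_pdivrMr //.
  have -> : 4 * H * R ^+ 2 * (H * q) = R ^+ 2 * (4 * H ^+ 2 * q) by ring.
  rewrite E9 ler_pM2l //.
  have : 64 * H ^+ 2 * q <= x ^+ 4 * q by rewrite ler_pM2r.
  have : 0 <= X ^+ 2 by exact: sqr_ge0.
  by clear - qX; lra.
Qed.

Lemma large_range_total (k H B d q l L tau A : K) :
  0 < k -> 1 <= L -> 1 <= tau -> 0 <= l -> l <= 2 * L -> 0 <= d -> 0 <= B -> 0 <= q ->
  H <= k ^+ 2 -> A <= k ^+ 2 -> d * B <= k ^+ 2 -> d * q <= k ^+ 2 ->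
  2 * k + k * L + (H + 4 * (tau ^+ 2 * (A + 2 * d * (4 * (B + q) * l)))) / k <=
  136 * (L * tau ^+ 2) * k.
Proof.
move=> k0 L1 tau1 l0 lL d0 B0 q0 b1 b2 b3 b4.
have L0 : 0 < L by exact: lt_le_trans L1.
have t2 : 1 <= tau ^+ 2 by rewrite exprn_ege1.
have k20 : 0 <= k ^+ 2 by exact: sqr_ge0.
have b5 : 2 * d * (4 * (B + q) * l) <= 32 * (L * k ^+ 2).
  have -> : 2 * d * (4 * (B + q) * l) = 8 * (d * B + d * q) * l by ring.
  have -> : 32 * (L * k ^+ 2) = 8 * (k ^+ 2 + k ^+ 2) * (2 * L) by ring.
  apply: ler_pM => //; last by rewrite ler_pM2l // lerD.
  by rewrite mulr_ge0 // addr_ge0 // mulr_ge0.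
have Lk : k ^+ 2 <= L * k ^+ 2 by rewrite ler_peMl.
have b6 : tau ^+ 2 * (A + 2 * d * (4 * (B + q) * l)) <= tau ^+ 2 * (33 * (L * k ^+ 2)).
  rewrite ler_wpM2l ?sqr_ge0 //; move: b5 Lk b2; clear; lra.
apply: (@le_trans _ _ (2 * k + k * L + (k ^+ 2 + 4 * (tau ^+ 2 * (33 * (L
  * k ^+ 2)))) / k)).
  by rewrite lerD2l ler_pM2r ?invr_gt0 // lerD // ler_pM2l.
have -> : 2 * k + k * L + (k ^+ 2 + 4 * (tau ^+ 2 * (33 * (L * k ^+ 2)))) / k =
   (3 + L + 132 * (L * tau ^+ 2)) * k by field; rewrite gt_eqF.
rewrite ler_pM2r //.
have : L <= L * tau ^+ 2 by rewrite ler_peMr // ltW.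
by clear - L1; lra.
Qed.

(** Here al is approximated to the order X^2 / x^4; on the minor arcs this forces
    q0 >= x^4 / 2, and the counting of coincidences is then efficient. *)
Lemma outer_sum_large (X x R H al L tau N : K) (b p : nat -> nat) :
  1 <= X -> 1 <= x -> x ^+ 6 <= X -> 0 < R -> 0 < H -> 0 <= al ->
  8 * H <= x ^+ 2 -> 8 * H * R ^+ 2 * x ^+ 4 <= X ^+ 2 ->
  16 * H ^+ 3 * R ^+ 2 <= 9 * X ^+ 2 -> X <= R ^+ 2 * x ^+ 2 ->
  1 <= L -> 1 + ln (3 * X) <= L -> 1 <= tau ->
  4 * H * R ^+ 2 <= N ->
  (forall n : nat, (0 < n)%N -> n%:R <= N -> (size (divisors n))%:R <= tau) ->
  (forall a q : nat, (0 < q)%N -> coprime a q ->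
    x ^+ 4 / 2 <= q%:R \/ x ^+ 4 / X ^+ 2 <= `|q%:R * al - a%:R|) ->
  (forall r, (0 < r)%N -> dyadic R r -> (0 < p r)%N) ->
  \sum_(1 <= r < (Num.truncn (2 * R)).+1 | dyadic R r)
     isqrt (approx_size (3 * X / r%:R) (r%:R ^+ 2 * al) (b r) (p r)) <=
  136 * (L * tau ^+ 2) * (R * isqrt H).
Proof.
move=> X1 x1 x6X R0 H0 al0 hH hl1 hl2 large L1 LX tau1 hN htau minor hp.
have X0 : 0 < X by exact: lt_le_trans X1.
have x0 : 0 < x by exact: lt_le_trans x1.
have V0 : 0 < 3 * X by exact: mulr_gt0.
have X20 : 0 < X ^+ 2 by rewrite exprn_gt0.
have x40 : 0 < x ^+ 4 by rewrite exprn_gt0.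
have x2X : x ^+ 2 <= X by apply: le_trans x6X; rewrite ler_weXn2l.
have E4 : x ^+ 4 = x ^+ 2 * x ^+ 2 by rewrite -exprD.
have HH : 64 * H ^+ 2 <= x ^+ 4.
  have -> : 64 * H ^+ 2 = (8 * H) * (8 * H) by ring.
  by rewrite E4; apply: ler_pM => //; rewrite mulr_ge0 // ltW.
have k0 : 0 < R * isqrt H by rewrite mulr_gt0 // invr_gt0 sqrtr_gt0.
pose n := (Num.truncn (X ^+ 2 / x ^+ 4)).+1.
have [a0 [q0 [/andP[q00 qn] cop close]]] := dirichlet_approximation al0 (isT : (0 < n)%N).
have Q0 : 0 < q0%:R :> K by rewrite ltr0n.
have close' : `|q0%:R * al - a0%:R| < x ^+ 4 / X ^+ 2.
  apply: lt_le_trans close _; rewrite -[leRHS]invf_div lef_pV2 ?posrE ?divr_gt0 //.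
  by rewrite ltW // truncnS_gt.
have qx : x ^+ 4 / 2 <= q0%:R.
  by have [//|h] := minor a0 q0 q00 cop; move: (lt_le_trans close' h); rewrite ltxx.
have qX : q0%:R * x ^+ 4 <= 2 * X ^+ 2.
  rewrite -ler_pdivlMr //; apply: (@le_trans _ _ n%:R); first by rewrite ler_nat.
  have Y1 : 1 <= X ^+ 2 / x ^+ 4.
    by rewrite ler_pdivlMr // mul1r E4 expr2; apply: ler_pM => //; exact: sqr_ge0.
  have : (Num.truncn (X ^+ 2 / x ^+ 4))%:R <= X ^+ 2 / x ^+ 4.
    by rewrite truncn_le; exact: le_trans Y1.
  by rewrite /n -natr1 -mulrA; move: Y1; clear; lra.
have cond1 : 4 * H * R ^+ 2 * `|q0%:R * al - a0%:R| <= 1 / 2.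
  apply: (@le_trans _ _ (4 * H * R ^+ 2 * (x ^+ 4 / X ^+ 2))).
    by rewrite ler_pM2l ?ltW // !mulr_gt0.
  by rewrite mulrA ler_pdivrMr //; move: hl1; clear; lra.
have LH : 1 + ln H <= L.
  apply: le_trans LX; rewrite lerD2l ler_ln ?posrE //.
  by move: hH x2X X0 H0; clear; lra.
have Lq : 1 + ln (q0%:R : K) <= 2 * L.
  have : ln (q0%:R : K) <= ln ((3 * X) ^+ 2).
    rewrite ler_ln ?posrE ?exprn_gt0 //.
    have : q0%:R * 1 <= q0%:R * x ^+ 4 by rewrite ler_pM2l // exprn_ege1.
    have -> : (3 * X) ^+ 2 = 9 * X ^+ 2 by ring.
    by move: qX X20; clear; lra.
  by rewrite lnXn // -[_ *+ 2]mulr_natl; move: LX; clear; lra.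
have htau' m : (0 < m)%N -> m%:R <= 4 * H * R ^+ 2 -> (size (divisors m))%:R <= tau.
  by move=> m0 mH; apply: htau => //; exact: le_trans hN.
apply: le_trans (large_sum b V0 R0 H0 k0 L1 LH q00 cop cond1 htau' hp) _.
have hR : x ^+ 4 <= R ^+ 2.
  by rewrite -(ler_pM2r (exprn_gt0 2 x0)) -exprD; exact: le_trans large.
have [b1 b2 b3 b4] := large_range_terms X0 x0 R0 H0 Q0 hR HH hl2 qx qX.
have k2 : (R * isqrt H) ^+ 2 = R ^+ 2 / H by rewrite exprMn isqrt_sqr // ltW.
rewrite -k2 in b1 b2 b3 b4.
have B0 : 0 <= 4 * H * R ^+ 2 by rewrite ltW // !mulr_gt0 // exprn_gt0.
rewrite -[2 * R * _]mulrA; apply: large_range_total => //.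
- by rewrite addr_ge0 // ln_ge0 // ler1n.
- by rewrite divr_ge0 // sqr_ge0.
Qed.

(** The two ranges of R overlap because x^6 <= X, that is sigma <= 1/6: beyond
    the first one R^2 >= X / x^2 >= x^4, which is what the diagonal terms of the
    second one require. *)
Lemma outer_sum (X x R H al L tau N : K) (b p : nat -> nat) :
  1 <= X -> 1 <= x -> x ^+ 6 <= X -> 0 < R -> 0 < H -> 0 <= al ->
  8 * H <= x ^+ 2 -> 8 * H * R ^+ 2 * x ^+ 4 <= X ^+ 2 ->
  16 * H ^+ 3 * R ^+ 2 <= 9 * X ^+ 2 ->
  1 <= L -> 1 + ln (3 * X) <= L -> 1 <= tau ->
  1 + 8 * H * R ^+ 2 <= N ->
  (forall n : nat, (0 < n)%N -> n%:R <= N -> (size (divisors n))%:R <= tau) ->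
  (forall a q : nat, (0 < q)%N -> coprime a q ->
    x ^+ 4 / 2 <= q%:R \/ x ^+ 4 / X ^+ 2 <= `|q%:R * al - a%:R|) ->
  (forall r, (0 < r)%N -> dyadic R r -> (0 < p r)%N /\ coprime (b r) (p r)) ->
  \sum_(1 <= r < (Num.truncn (2 * R)).+1 | dyadic R r)
     isqrt (approx_size (3 * X / r%:R) (r%:R ^+ 2 * al) (b r) (p r)) <=
  136 * (L * tau ^+ 2) * (R * isqrt H).
Proof.
move=> X1 x1 x6X R0 H0 al0 hH hl1 hl2 L1 LX tau1 hN htau minor hp.
have [small|/ltW large] := lerP (R ^+ 2 * x ^+ 2) X.
  have h := outer_sum_small X1 x1 R0 H0 al0 hH small tau1 hN htau minor hp.
  apply: le_trans h _.
  rewrite ler_wpM2r ?mulr_ge0 ?isqrt_ge0 ?(ltW R0) //.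
  have tau0 : 0 <= tau by exact: le_trans tau1.
  have : tau <= tau ^+ 2 by rewrite expr2 ler_peMl.
  have : tau ^+ 2 <= L * tau ^+ 2 by rewrite ler_peMl ?sqr_ge0.
  by move: tau0; clear; lra.
have hN' : 4 * H * R ^+ 2 <= N.
  have : 0 <= H * R ^+ 2 by rewrite mulr_ge0 ?sqr_ge0 // ltW.
  by move: hN; clear; lra.
by apply: outer_sum_large hN' htau minor _ => // r r0 /(hp r r0)[].
Qed.

(** For fixed r, Weyl's bound for every s followed by the descent in s. *)
Lemma inner_sum (X R S H al L tau N : K) (r : nat) :
  1 <= X -> 0 < R -> 0 < S -> 0 < H -> 0 <= al -> (0 < r)%N -> dyadic R r ->
  H * (1 + 8 * H * S ^+ 2) * (4 * S ^+ 2) / (3 * X / r%:R) ^+ 2 <= 1 / 2 ->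
  H * (4 * R * S) <= 3 * X ->
  1 <= L -> 1 + ln (3 * X) <= L -> 1 + 8 * H * S ^+ 2 <= N ->
  (forall n : nat, (0 < n)%N -> n%:R <= N -> (size (divisors n))%:R <= tau) ->
  exists c p : nat, [/\ (0 < p)%N, coprime c p &
  \sum_(1 <= s < (Num.truncn (2 * S)).+1 | dyadic S s)
    cabs (\sum_(1 <= m < (Num.truncn (2 * X)).+1 | dyadic X (r * s * m)%N)
        e (al * r%:R ^+ 2 * s%:R ^+ 2 * m%:R ^+ 2)) <=
  144 * L * (X / R) *
    (2 * isqrt H + tau * isqrt (approx_size (3 * X / r%:R) (r%:R ^+ 2 * al) c p))].
Proof.
move=> X1 R0 S0 H0 al0 r0 dyr cond hHP L1 LX hN htau.
have X0 : 0 < X by exact: lt_le_trans X1.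
have X30 : 0 < 3 * X by exact: mulr_gt0.
have L0 : 0 < L by exact: lt_le_trans L1.
have RR : 0 < r%:R :> K by rewrite ltr0n.
have V0 : 0 < 3 * X / r%:R by rewrite divr_gt0.
have b0 : 0 <= r%:R ^+ 2 * al by rewrite mulr_ge0 ?sqr_ge0.
have /andP[r1 r2] := dyr.
pose f s := \sum_(1 <= m < (Num.truncn (2 * X)).+1 | dyadic X (r * s * m)%N)
        e (al * r%:R ^+ 2 * s%:R ^+ 2 * m%:R ^+ 2).
have ex (s : nat) : exists aq : nat * nat, (0 < s)%N -> dyadic S s ->
   [/\ (0 < aq.2)%N, coprime aq.1 aq.2 & cabs (f s) <= 72 * L * (X / (R * S)) *
     (isqrt H + isqrt (approx_size (3 * X / r%:R / s%:R) (s%:R ^+ 2 * (r%:R ^+ 2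
       * al)) aq.1 aq.2))].
  case: (posnP s) => [->|s0]; first by exists (0%N, 0%N).
  case dys: (dyadic S s); last by exists (0%N, 0%N).
  have /andP[s1 s2] := dys.
  have SS : 0 < s%:R :> K by rewrite ltr0n.
  have rs0 : (0 < r * s)%N by rewrite muln_gt0 r0.
  have RS0 : 0 < (r * s)%N%:R :> K by rewrite ltr0n.
  have [c [n [nP E]]] := dyadic_interval (fun m : nat => e (al * r%:R ^+ 2
    * s%:R ^+ 2 * m%:R ^+ 2)) X0 rs0.
  set P := 3 * X / (r * s)%N%:R in nP.
  have EP : P = 3 * X / r%:R / s%:R by rewrite /P natrM invfM mulrA.
  have P0 : 0 < P by rewrite divr_gt0.
  have HP : 0 < H <= P.
    rewrite H0 /= /P ler_pdivlMr //; apply: le_trans hHP; rewrite ler_pM2l // natrM.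
    have -> : 4 * R * S = (2 * R) * (2 * S) by ring.
    by apply: ler_pM.
  have LP : 1 + ln P <= L.
    apply: le_trans LX; rewrite lerD2l ler_ln ?posrE //.
    by rewrite /P ler_pdivrMr // ler_peMr ?ler1n // ltW.
  have bb0 : 0 <= s%:R ^+ 2 * (r%:R ^+ 2 * al) by rewrite mulr_ge0 ?sqr_ge0.
  have [a [q [q0 cop h]]] := weyl_bound c bb0 nP HP L1 LP.
  exists (a, q) => _ _; split => //=.
  rewrite /f E.
  rewrite (eq_bigr (fun i => e (s%:R ^+ 2 * (r%:R ^+ 2 * al) * (c + i)%N%:R ^+ 2)));
    last first.
    by move=> i _; congr e; ring.
  apply: le_trans h _; rewrite -EP -/(approx_size P _ a q).
  rewrite ler_wpM2r ?addr_ge0 ?isqrt_ge0 //.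
  have -> : 72 * L * (X / (R * S)) = 24 * L * (3 * X / (R * S)) by ring.
  rewrite ler_pM2l ?mulr_gt0 // /P ler_pM2l //.
  by rewrite lef_pV2 ?posrE ?mulr_gt0 // natrM; apply: ler_pM; rewrite ltW.
have [aq haq] := choice ex.
pose a s := (aq s).1; pose q s := (aq s).2.
have hq s : (0 < s)%N -> dyadic S s -> (0 < q s)%N /\ coprime (a s) (q s).
  by move=> s0 dys; have [] := haq s s0 dys.
have [c [p [p0 cop pN h]]] := descent_sum b0 V0 S0 H0 cond hq.
exists c, p; split => //.
set w := isqrt (approx_size _ _ c p) in h *.
have w0 : 0 <= w by exact: isqrt_ge0.
have i0 := isqrt_ge0 H.
set G := 72 * L * (X / (R * S)).
have G0 : 0 <= G by rewrite ltW // mulr_gt0 ?divr_gt0 ?mulr_gt0.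
have mS : (Num.truncn (2 * S))%:R <= 2 * S by rewrite truncn_le mulr_ge0 // ltW.
apply: (@le_trans _ _ (G * (2 * S * isqrt H + 2 * S * (isqrt H + tau * w)))).
  apply: (@le_trans _ _ (G * ((\sum_(1 <= s < (Num.truncn (2 * S)).+1) isqrt H) +
    \sum_(1 <= s < (Num.truncn (2 * S)).+1
      | dyadic S s) isqrt (approx_size (3 * X / r%:R / s%:R) (s%:R ^+ 2 * (r%:R ^+ 2
      * al)) (a s) (q s))))).
    rewrite [X in _ <= _ * (_ + X)]big_mkcond -big_split /= mulr_sumr.
    rewrite big_mkcond big_nat_cond [leRHS]big_nat_cond;
      apply: ler_sum => s /andP[/andP[s0 _] _].
    case: ifP => [dys|_]; last by rewrite addr0 mulr_ge0.
    by have [_ _] := haq s s0 dys.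
  rewrite ler_wpM2l //; apply: lerD.
    by rewrite sumr_const_nat subn1 -[_ *+ _]mulr_natl; apply: ler_wpM2r.
  apply: le_trans h _; rewrite ler_pM2l ?mulr_gt0 // lerD2l ler_wpM2r //.
  by apply: htau => //; apply: le_trans hN.
rewrite le_eqVlt; apply/orP; left; apply/eqP; rewrite /G; field.
by rewrite ?gt_eqF.
Qed.
End Assembly.

(** * The bound for the type I sum *)

(** The conditions under which H = x^2 / (8 c^2) is an admissible level. In terms
    of u = R x^3 <= c X and v = R S^2 x^2 <= X / 10 each of them follows
    from a bound for u^2, v^2 or u v. *)
Lemma level_conditions (K : realType) (X x R S c H : K) :
  1 <= X -> 1 <= x -> 0 < R -> 0 < S -> 0 < H -> 1 <= c ->
  R * x ^+ 3 <= c * X -> R * S ^+ 2 * x ^+ 2 <= X / 10 -> 8 * c ^+ 2 * H = x ^+ 2 ->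
  [/\ 8 * H * R ^+ 2 * x ^+ 4 <= X ^+ 2, 16 * H ^+ 3 * R ^+ 2 <= 9 * X ^+ 2,
      H * (4 * R * S) <= 3 * X &
      16 * (H * R ^+ 2 * S ^+ 2) + 128 * (H ^+ 2 * R ^+ 2 * S ^+ 4) <= 9 * X ^+ 2 / 2].
Proof.
move=> X1 x1 R0 S0 H0 c1 Rx RSx EH.
have X0 : 0 < X by exact: lt_le_trans X1.
have x0 : 0 < x by exact: lt_le_trans x1.
have c0 : 0 < c by exact: lt_le_trans c1.
have c20 : 0 < c ^+ 2 by rewrite exprn_gt0.
have c21 : 1 <= c ^+ 2 by rewrite exprn_ege1.
have c41 : 1 <= c ^+ 2 * c ^+ 2 by rewrite -[1]mul1r; apply: ler_pM.
have X20 : 0 < X ^+ 2 by rewrite exprn_gt0.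
pose u := R * x ^+ 3; pose v := R * S ^+ 2 * x ^+ 2.
have u0 : 0 < u by rewrite mulr_gt0 // exprn_gt0.
have v0 : 0 < v by rewrite !mulr_gt0 // exprn_gt0.
have u2 : u ^+ 2 <= c ^+ 2 * X ^+ 2.
  by rewrite -exprMn ler_sqr ?nnegrE ?(ltW u0) ?mulr_ge0 ?(ltW c0) ?(ltW X0).
have v2 : v ^+ 2 <= X ^+ 2 / 100.
  have -> : X ^+ 2 / 100 = (X / 10) ^+ 2 by field.
  by rewrite ler_sqr ?nnegrE ?divr_ge0 ?(ltW v0) ?(ltW X0).
have uv : u * v <= c * X * (X / 10) by apply: ler_pM; rewrite ?(ltW u0) ?(ltW v0).
have hl1 : 8 * H * R ^+ 2 * x ^+ 4 <= X ^+ 2.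
  rewrite -(ler_pM2l c20).
  have -> : c ^+ 2 * (8 * H * R ^+ 2 * x ^+ 4) = (8 * c ^+ 2 * H) * R ^+ 2 * x ^+ 4 by ring.
  by rewrite EH (_ : x ^+ 2 * R ^+ 2 * x ^+ 4 = u ^+ 2) // /u; ring.
have hl2 : 16 * H ^+ 3 * R ^+ 2 <= 9 * X ^+ 2.
  have h1 : 512 * (H ^+ 3 * R ^+ 2) * (c ^+ 2 * c ^+ 2) * c ^+ 2 <= X ^+ 2 * c ^+ 2.
    have -> : 512 * (H ^+ 3 * R ^+ 2) * (c ^+ 2 * c ^+ 2) * c ^+ 2
      = (8 * c ^+ 2 * H) ^+ 3 * R ^+ 2 by ring.
    by rewrite EH (_ : (x ^+ 2) ^+ 3 * R ^+ 2 = u ^+ 2) ?[X ^+ 2 * _]mulrC // /u; ring.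
  rewrite ler_pM2r // in h1.
  have h3 : 0 <= H ^+ 3 * R ^+ 2 by rewrite mulr_ge0 ?exprn_ge0 ?(ltW H0) ?(ltW R0).
  have h2 : H ^+ 3 * R ^+ 2 * 1 <= H ^+ 3 * R ^+ 2 * (c ^+ 2 * c ^+ 2) by rewrite ler_wpM2l.
  lra.
have RS1 : 80 * (H * R ^+ 2 * S ^+ 2) <= X ^+ 2.
  have cx0 : 0 < c ^+ 2 * x ^+ 3 by rewrite mulr_gt0 // exprn_gt0.
  rewrite -(ler_pM2r cx0).
  have -> : 80 * (H * R ^+ 2 * S ^+ 2) * (c ^+ 2 * x ^+ 3)
    = 10 * (8 * c ^+ 2 * H) * (R ^+ 2 * S ^+ 2 * x ^+ 3) by ring.
  rewrite EH (_ : 10 * x ^+ 2 * (R ^+ 2 * S ^+ 2 * x ^+ 3) = 10 * (u * v));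
    last by rewrite /u /v; ring.
  apply: (@le_trans _ _ (X ^+ 2 * c)).
    have -> : X ^+ 2 * c = 10 * (c * X * (X / 10)) by field.
    by rewrite ler_pM2l.
  rewrite ler_pM2l //; apply: (@le_trans _ _ (c ^+ 2));
    first by rewrite expr2 ler_peMl // ltW.
  by rewrite ler_peMr ?(ltW c20) // exprn_ege1.
have RS2 : 100 * (64 * (H ^+ 2 * R ^+ 2 * S ^+ 4)) <= X ^+ 2.
  have h1 : 64 * (H ^+ 2 * R ^+ 2 * S ^+ 4) * (c ^+ 2 * c ^+ 2) <= X ^+ 2 / 100.
    have -> : 64 * (H ^+ 2 * R ^+ 2 * S ^+ 4) * (c ^+ 2 * c ^+ 2)
      = (8 * c ^+ 2 * H) ^+ 2 * R ^+ 2 * S ^+ 4 by ring.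
    by rewrite EH (_ : (x ^+ 2) ^+ 2 * R ^+ 2 * S ^+ 4 = v ^+ 2) // /v; ring.
  have h3 : 0 <= H ^+ 2 * R ^+ 2 * S ^+ 4.
    by rewrite !mulr_ge0 ?exprn_ge0 ?(ltW H0) ?(ltW R0) ?(ltW S0).
  have h2 : H ^+ 2 * R ^+ 2 * S ^+ 4 * 1
    <= H ^+ 2 * R ^+ 2 * S ^+ 4 * (c ^+ 2 * c ^+ 2) by rewrite ler_wpM2l.
  lra.
have HP : H * (4 * R * S) <= 3 * X.
  rewrite -ler_sqr ?nnegrE ?mulr_ge0 ?(ltW H0) ?(ltW R0) ?(ltW S0) ?(ltW X0) //.
  have -> : (H * (4 * R * S)) ^+ 2 = 16 * (H ^+ 2 * R ^+ 2 * S ^+ 2) by ring.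
  have -> : (3 * X) ^+ 2 = 9 * X ^+ 2 by ring.
  have h1 : H ^+ 2 * R ^+ 2 * S ^+ 2 * (64 * (c ^+ 2 * c ^+ 2) * x) = u * v.
    have -> : H ^+ 2 * R ^+ 2 * S ^+ 2 * (64 * (c ^+ 2 * c ^+ 2) * x)
      = (8 * c ^+ 2 * H) ^+ 2 * R ^+ 2 * S ^+ 2 * x by ring.
    by rewrite EH /u /v; ring.
  have h2 : c <= 64 * (c ^+ 2 * c ^+ 2) * x.
    apply: (@le_trans _ _ (c ^+ 2)); first by rewrite expr2 ler_peMl // ltW.
    have g1 : c ^+ 2 * 1 <= c ^+ 2 * c ^+ 2 by rewrite ler_pM2l.
    have g2 : c ^+ 2 * c ^+ 2 <= c ^+ 2 * c ^+ 2 * x by rewrite ler_peMr // mulr_ge0 // ltW.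
    have -> : 64 * (c ^+ 2 * c ^+ 2) * x = 64 * (c ^+ 2 * c ^+ 2 * x) by ring.
    lra.
  have h3 : 0 <= H ^+ 2 * R ^+ 2 * S ^+ 2
    by rewrite !mulr_ge0 ?exprn_ge0 ?(ltW H0) ?(ltW R0) ?(ltW S0).
  have h4 : H ^+ 2 * R ^+ 2 * S ^+ 2 * c <= X ^+ 2 / 10 * c.
    apply: le_trans (ler_wpM2l h3 h2) _; rewrite h1; apply: le_trans uv _.
    by rewrite le_eqVlt; apply/orP; left; apply/eqP; ring.
  rewrite ler_pM2r // in h4; lra.
split => //; move: RS1 RS2 X20; clear; lra.
Qed.

(** Every denominator met in the two descents is bounded by a fixed
    multiple of X^3, so that it has few divisors. *)
Lemma denominator_ranges (K : realType) (X x R S c H : K) :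
  1 <= X -> 1 <= x -> 0 < R -> 0 < S -> 1 <= c -> 8 * H <= x ^+ 2 ->
  R * x ^+ 3 <= c * X -> R * S ^+ 2 * x ^+ 2 <= X / 10 ->
  1 + 8 * H * R ^+ 2 <= (3 + 8 * c ^+ 2) * X ^+ 3 /\
  (1 <= 2 * R -> 1 + 8 * H * S ^+ 2 <= (3 + 8 * c ^+ 2) * X ^+ 3).
Proof.
move=> X1 x1 R0 S0 c1 hH Rx RSx.
have X0 : 0 < X by exact: lt_le_trans X1.
have x0 : 0 < x by exact: lt_le_trans x1.
have c0 : 0 < c by exact: lt_le_trans c1.
have c20 : 0 < c ^+ 2 by rewrite exprn_gt0.
have X3 : 1 <= X ^+ 3 by rewrite exprn_ege1.
have cX0 : 0 <= c ^+ 2 * X ^+ 3 by rewrite mulr_ge0 ?exprn_ge0 // ltW.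
have s20 : 0 < S ^+ 2 by rewrite exprn_gt0.
split.
  have u2 : R ^+ 2 * x ^+ 6 <= c ^+ 2 * X ^+ 2.
    have -> : R ^+ 2 * x ^+ 6 = (R * x ^+ 3) ^+ 2 by rewrite exprMn -exprM.
    by rewrite -exprMn ler_sqr ?nnegrE ?mulr_ge0 ?exprn_ge0 ?(ltW R0) ?(ltW x0) ?(ltW
      c0) ?(ltW X0).
  have h1 : 8 * H * R ^+ 2 <= x ^+ 2 * R ^+ 2 by rewrite ler_pM2r // exprn_gt0.
  have h2 : x ^+ 2 * R ^+ 2 <= R ^+ 2 * x ^+ 6.
    by rewrite mulrC ler_pM2l ?exprn_gt0 // ler_weXn2l.
  have h3 : c ^+ 2 * X ^+ 2 <= c ^+ 2 * X ^+ 3 by rewrite ler_pM2l // ler_weXn2l.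
  by move: u2 h1 h2 h3 X3 cX0; clear; lra.
move=> R1.
have X13 : X <= X ^+ 3 by rewrite -[leLHS]expr1 ler_weXn2l.
have h1 : 8 * H * S ^+ 2 <= x ^+ 2 * S ^+ 2 by rewrite ler_pM2r.
have h2 : x ^+ 2 * S ^+ 2 <= x ^+ 2 * S ^+ 2 * (2 * R).
  by rewrite ler_peMr // ltW // mulr_gt0 // exprn_gt0.
have h3 : x ^+ 2 * S ^+ 2 * (2 * R) = 2 * (R * S ^+ 2 * x ^+ 2) by ring.
by move: RSx h1 h2 h3 X3 X13 cX0; clear; lra.
Qed.

(** The estimate with explicit dependence on the logarithm L, on the bound tau
    for the divisor function and on the bound Xi for the coefficients. *)
Lemma type_I_sum_bound (K : realType) (X x R S al c L tau Xi : K) (xi : nat -> nat ->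
  K[i]) :
  1 <= X -> 1 <= x -> x ^+ 6 <= X -> 0 < R -> 0 < S -> 0 <= al -> 1 <= c ->
  R * x ^+ 3 <= c * X -> R * S ^+ 2 * x ^+ 2 <= X / 10 ->
  1 <= L -> 1 + ln (3 * X) <= L -> 1 <= tau ->
  (forall n : nat, (0 < n)%N -> n%:R <= (3 + 8 * c ^+ 2) * X ^+ 3 ->
     (size (divisors n))%:R <= tau) ->
  (forall a q : nat, (0 < q)%N -> coprime a q ->
    x ^+ 4 / 2 <= q%:R \/ x ^+ 4 / X ^+ 2 <= `|q%:R * al - a%:R|) ->
  0 <= Xi ->
  (forall r s : nat, (0 < r)%N -> (0 < s)%N -> dyadic R r -> dyadic S s -> cabs (xi r
    s) <= Xi) ->
  cabs (type_I_sum X R S al xi) <= Xi * (144 * 420 * c * L ^+ 2 * tau ^+ 3 * (X / x)).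
Proof.
move=> X1 x1 x6X R0 S0 al0 c1 Rx RSx L1 LX tau1 htau minor Xi0 hxi.
have X0 : 0 < X by exact: lt_le_trans X1.
have x0 : 0 < x by exact: lt_le_trans x1.
have c0 : 0 < c by exact: lt_le_trans c1.
have L0 : 0 <= L by exact: le_trans L1.
have tau0 : 0 <= tau by exact: le_trans tau1.
have c20 : 0 < c ^+ 2 by rewrite exprn_gt0.
have x20 : 0 < x ^+ 2 by rewrite exprn_gt0.
have [H H0 EH] : exists2 H : K, 0 < H & 8 * c ^+ 2 * H = x ^+ 2.
  exists (x ^+ 2 / (8 * c ^+ 2)); first by rewrite divr_gt0 // mulr_gt0.
  by rewrite mulrC divfK // gt_eqF // mulr_gt0.
have hH : 8 * H <= x ^+ 2.
  by rewrite -EH -[8 * H]mul1r mulrA ler_pM2r // [leRHS]mulrC ler_pM2r // exprn_ege1.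
have [hl1 hl2 HP RS] := level_conditions X1 x1 R0 S0 H0 c1 Rx RSx EH.
have [N1 N2] := denominator_ranges X1 x1 R0 S0 c1 hH Rx RSx.
have cond r : (0 < r)%N -> dyadic R r ->
    H * (1 + 8 * H * S ^+ 2) * (4 * S ^+ 2) / (3 * X / r%:R) ^+ 2 <= 1 / 2.
  move=> r0 /andP[r1 r2]; have RR : 0 < r%:R :> K by rewrite ltr0n.
  rewrite ler_pdivrMr ?exprn_gt0 ?divr_gt0 ?mulr_gt0 //.
  have -> : 1 / 2 * (3 * X / r%:R) ^+ 2 = 9 * X ^+ 2 / 2 / r%:R ^+ 2 by field;
    rewrite gt_eqF.
  rewrite ler_pdivlMr ?exprn_gt0 //.
  apply: (@le_trans _ _ (H * (1 + 8 * H * S ^+ 2) * (4 * S ^+ 2) * (2 * R) ^+ 2)).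
    rewrite ler_pM2l ?ler_sqr ?nnegrE ?mulr_ge0 ?(ltW RR) ?(ltW R0) //.
    have s20 : 0 < S ^+ 2 by rewrite exprn_gt0.
    rewrite !mulr_gt0 // ltr_pwDl // !mulr_ge0 // ltW //.
  have -> : H * (1 + 8 * H * S ^+ 2) * (4 * S ^+ 2) * (2 * R) ^+ 2 =
     16 * (H * R ^+ 2 * S ^+ 2) + 128 * (H ^+ 2 * R ^+ 2 * S ^+ 4) by ring.
  exact: RS.
pose f r s := \sum_(1 <= m < (Num.truncn (2 * X)).+1 | dyadic X (r * s * m)%N)
        e (al * r%:R ^+ 2 * s%:R ^+ 2 * m%:R ^+ 2).
have ex (r : nat) : exists cp : nat * nat, (0 < r)%N -> dyadic R r ->
   [/\ (0 < cp.2)%N, coprime cp.1 cp.2 &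
    \sum_(1 <= s < (Num.truncn (2 * S)).+1 | dyadic S s) cabs (f r s) <=
    144 * L * (X / R) * (2 * isqrt H + tau * isqrt (approx_size (3
      * X / r%:R) (r%:R ^+ 2 * al) cp.1 cp.2))].
  case: (posnP r) => [->|r0]; first by exists (0%N, 0%N).
  case dyr: (dyadic R r); last by exists (0%N, 0%N).
  have R1 : 1 <= 2 * R by case/andP: dyr => _; apply: le_trans; rewrite ler1n.
  have [b [p [p0 cop h]]] := inner_sum X1 R0 S0 H0 al0 r0 dyr (cond r r0 dyr) HP L1 LX
    (N2 R1) htau.
  by exists (b, p).
have [bp hbp] := choice ex.
pose b r := (bp r).1; pose p r := (bp r).2.
have hp r : (0 < r)%N -> dyadic R r -> (0 < p r)%N /\ coprime (b r) (p r).
  by move=> r0 dyr; have [] := hbp r r0 dyr.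
have hr := outer_sum X1 x1 x6X R0 H0 al0 hH hl1 hl2 L1 LX tau1 N1 htau minor hp.
have i0 := isqrt_ge0 H.
have mR : (Num.truncn (2 * R))%:R <= 2 * R by rewrite truncn_le mulr_ge0 // ltW.
set G := 144 * L * (X / R) in hbp.
have G0 : 0 <= G.
  by apply: mulr_ge0; [exact: mulr_ge0 | apply: divr_ge0; exact: ltW].
have step : cabs (type_I_sum X R S al xi) <=
   Xi * (\sum_(1 <= r < (Num.truncn (2 * R)).+1 | dyadic R r)
     \sum_(1 <= s < (Num.truncn (2 * S)).+1 | dyadic S s) cabs (f r s)).
  apply: le_trans (cabs_sum _ _ _) _; rewrite mulr_sumr.
  rewrite big_nat_cond [leRHS]big_nat_cond; apply: ler_sum => r /andP[/andP[r0 _] dyr].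
  apply: le_trans (cabs_sum _ _ _) _; rewrite mulr_sumr.
  rewrite big_nat_cond [leRHS]big_nat_cond; apply: ler_sum => s /andP[/andP[s0 _] dys].
  rewrite -mulr_sumr cabsM ler_wpM2r ?cabs_ge0 //; exact: hxi.
apply: le_trans step _; rewrite ler_wpM2l //.
apply: (@le_trans _ _ (G * ((\sum_(1 <= r < (Num.truncn (2 * R)).+1) 2 * isqrt H) +
   tau * \sum_(1 <= r < (Num.truncn (2 * R)).+1 | dyadic R r)
     isqrt (approx_size (3 * X / r%:R) (r%:R ^+ 2 * al) (b r) (p r))))).
  rewrite [X in _ <= _ * (_ + _ * X)]big_mkcond mulr_sumr -big_split /= mulr_sumr.
  rewrite big_mkcond big_nat_cond [leRHS]big_nat_cond;
    apply: ler_sum => r /andP[/andP[r0 _] _].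
  case: ifP => [dyr|_]; last by rewrite mulr0 addr0 mulr_ge0 // mulr_ge0.
  by have [_ _] := hbp r r0 dyr.
have hh : isqrt H <= 3 * c / x.
  rewrite -ler_sqr ?nnegrE ?divr_ge0 ?mulr_ge0 ?(ltW c0) ?(ltW x0) // isqrt_sqr ?(ltW
    H0) //.
  have -> : H^-1 = 8 * c ^+ 2 / x ^+ 2 by rewrite -EH; field; rewrite !gt_eqF.
  rewrite ler_pdivrMr //.
  have -> : (3 * c / x) ^+ 2 * x ^+ 2 = 9 * c ^+ 2 by field; rewrite gt_eqF.
  by rewrite ler_pM2r // ler_nat.
apply: (@le_trans _ _ (G * (140 * (L * tau ^+ 3) * (R * isqrt H)))).
  rewrite ler_wpM2l //.
  have h1 : \sum_(1 <= r < (Num.truncn (2 * R)).+1) 2 * isqrt H <= 4 * (R * isqrt H).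
    rewrite sumr_const_nat subn1 -[_ *+ _]mulr_natl /=.
    have -> : 4 * (R * isqrt H) = 2 * R * (2 * isqrt H) by ring.
    by rewrite ler_wpM2r // mulr_ge0.
  have h2 := ler_wpM2l tau0 hr.
  have h3 : 4 * (R * isqrt H) <= 4 * (L * tau ^+ 3) * (R * isqrt H).
    rewrite ler_wpM2r ?mulr_ge0 ?(ltW R0) // ler_peMr // -[1]mul1r.
    by apply: ler_pM => //; rewrite exprn_ege1.
  have -> : 140 * (L * tau ^+ 3) * (R * isqrt H) = 4 * (L * tau ^+ 3) * (R * isqrt H) +
     tau * (136 * (L * tau ^+ 2) * (R * isqrt H)) by ring.
  by apply: lerD => //; exact: le_trans h3.
have -> : 144 * 420 * c * L ^+ 2 * tau ^+ 3 * (X / x)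
  = 144 * 140 * (L ^+ 2 * tau ^+ 3 * X) * (3 * c / x).
  by field; rewrite gt_eqF.
have -> : G * (140 * (L * tau ^+ 3) * (R * isqrt H))
  = 144 * 140 * (L ^+ 2 * tau ^+ 3 * X) * isqrt H.
  by rewrite /G; field; rewrite gt_eqF.
have k0 : 0 <= 144 * 140 :> K by rewrite -natrM ler0n.
have LX0 : 0 <= L ^+ 2 * tau ^+ 3 * X by rewrite !mulr_ge0 ?exprn_ge0 ?(ltW X0).
by apply: ler_wpM2l hh; exact: mulr_ge0.
Qed.

Theorem lemma3p2 (K : realType) (sigma : K) (hsigma : 0 < sigma < 1 / 6)
    (A : K -> K) (c : K) (epsilon : K) (hepsilon : 0 < epsilon) :
  exists C : K, 0 < C /\
    forall (X R S alpha : K) (xi : nat -> nat -> K[i]),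
      1 <= X -> 0 < R -> 0 < S ->
      alpha \in minor_arcs sigma X ->
      (forall eta : K, 0 < eta -> forall r s : nat, (0 < r)%N -> (0 < s)%N ->
         `|xi r s| <= (A eta * (r * s)%N%:R `^ eta)%:C) ->
      R <= c * X `^ (1 - 3 * sigma) ->
      R * S ^+ 2 <= 1 / 10 * X `^ (1 - 2 * sigma) ->
      `|type_I_sum X R S alpha xi| <= (C * X `^ (1 - sigma + epsilon))%:C.
Proof.
(* six factors X^eta occur: one from the coefficients, two from logarithms and
   three from the divisor function *)
pose eta := epsilon / 6; have eta0 : 0 < eta by rewrite divr_gt0.
have eta30 : 0 < eta / 3 by rewrite divr_gt0.
pose c1 := 1 + `|c|.
have c11 : 1 <= c1 by rewrite lerDl.
have [Cd Cd1 hd] := divisor_bound eta30.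
pose M := 3 + 8 * c1 ^+ 2.
have M1 : 1 <= M by rewrite /M; move: (sqr_ge0 c1); clear; lra.
pose Ct := Cd * M `^ (eta / 3); pose CL := (1 + eta^-1) * 3 `^ eta.
pose Cx := `|A eta| * (4 * c1) `^ eta.
have Ct1 : 1 <= Ct.
  by rewrite -[1]mul1r; apply: ler_pM => //; rewrite -[leLHS](powRr0 M) ler_powR // ltW.
have CL1 : 1 <= CL.
  rewrite -[1]mul1r; apply: ler_pM => //; first by rewrite lerDl invr_ge0 ltW.
  by rewrite -[leLHS](powRr0 (3 : K)) ler_powR ?ler1n // ltW.
have Cx0 : 0 <= Cx by rewrite mulr_ge0 // powR_ge0.
have [kc Ekc] : exists k : K, k = 144 * 420 by eexists.
have kc0 : 0 < kc by rewrite Ekc -natrM ltr0n muln_gt0.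
have CL0 : 0 < CL by exact: lt_le_trans CL1.
have Ct0 : 0 < Ct by exact: lt_le_trans Ct1.
have c10 : 0 < c1 by exact: lt_le_trans c11.
have Cx10 : 0 < Cx + 1 by exact: ltr_wpDl.
have Z0 : 0 < kc * c1 * CL ^+ 2 * Ct ^+ 3.
  apply: mulr_gt0; last by rewrite exprn_gt0.
  by apply: mulr_gt0; [exact: mulr_gt0 | rewrite exprn_gt0].
exists ((Cx + 1) * (kc * c1 * CL ^+ 2 * Ct ^+ 3)); split; first exact: mulr_gt0.
move=> X R S al xi X1 R0 S0 hal hxi hR hRS.
have X0 : 0 < X by exact: lt_le_trans X1.
pose x := X `^ sigma; have /andP[s0 s6] := hsigma.
have x1 : 1 <= x by rewrite -[leLHS](powRr0 X) ler_powR // ltW.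
have x0 : 0 < x by exact: lt_le_trans x1.
have xn n : X `^ (n%:R * sigma) = x ^+ n by rewrite mulrC powRrM powR_mulrn // ltW.
have x6X : x ^+ 6 <= X.
  rewrite -xn -[leRHS](powRr1 (ltW X0)) ler_powR //.
  by move: s6; clear; lra.
have Xsub t : X `^ (1 - t) = X / X `^ t.
  by rewrite powRB ?powRr1 ?(ltW X0) // (gt_eqF X0) implybT.
have hR' : R * x ^+ 3 <= c1 * X.
  rewrite -ler_pdivlMr ?exprn_gt0 // -mulrA; apply: le_trans hR _.
  rewrite Xsub xn ler_wpM2r ?divr_ge0 ?exprn_ge0 ?(ltW X0) ?(ltW x0) //.
  by rewrite /c1; move: (ler_norm c); clear; lra.
have hRS' : R * S ^+ 2 * x ^+ 2 <= X / 10.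
  rewrite -ler_pdivlMr ?exprn_gt0 //; apply: le_trans hRS _.
  by rewrite Xsub xn le_eqVlt; apply/orP; left; apply/eqP; field; rewrite gt_eqF.
pose T := X `^ eta.
have T1 : 1 <= T by rewrite -[leLHS](powRr0 X) ler_powR // ltW.
have [al0 minor] := minor_arc_approx hsigma X1 hal.
have L1 : 1 <= CL * T by rewrite -[1]mul1r; apply: ler_pM.
have LX : 1 + ln (3 * X) <= CL * T.
  have X31 : 1 <= 3 * X by move: X1; clear; lra.
  apply: le_trans (ln_le_powR eta0 X31) _; rewrite powRM ?(ltW X0) //.
  by rewrite mulrA.
have tau1 : 1 <= Ct * T by rewrite -[1]mul1r; apply: ler_pM.
have htau (n : nat) : (0 < n)%N -> n%:R <= M * X ^+ 3 -> (size (divisors n))%:R <= Ct * T.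
  move=> n0 nN; apply: le_trans (hd n n0) _; rewrite /Ct -mulrA ler_pM2l;
    last exact: lt_le_trans Cd1.
  have -> : T = (X ^+ 3) `^ (eta / 3).
    by rewrite -powR_mulrn ?(ltW X0) // -powRrM /T; congr (_ `^ _); field.
  have M0 : 0 <= M by exact: le_trans M1.
  rewrite -powRM ?exprn_ge0 ?(ltW X0) //.
  by apply: ge0_ler_powR; rewrite ?nnegrE ?(ltW eta30) // mulr_ge0 ?exprn_ge0 ?(ltW X0).
have hXi r s : (0 < r)%N -> (0 < s)%N -> dyadic R r -> dyadic S s -> cabs (xi r s)
  <= Cx * T.
  move=> r0 s0' /andP[_ r2] /andP[_ s2].
  have := hxi eta eta0 r s r0 s0'; rewrite cabsE lecR => /le_trans; apply.
  apply: (@le_trans _ _ (`|A eta| * (r * s)%N%:R `^ eta)).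
    by rewrite ler_wpM2r ?powR_ge0 // ler_norm.
  have c40 : 0 <= 4 * c1 by rewrite mulr_ge0 // ltW.
  rewrite /Cx -mulrA ler_wpM2l // -powRM ?(ltW X0) //.
  apply: ge0_ler_powR; rewrite ?nnegrE ?(ltW eta0) //; first by rewrite mulr_ge0 ?(ltW X0).
  rewrite natrM; apply: (@le_trans _ _ ((2 * R) * (2 * S))); first by apply: ler_pM.
  have h1 : R <= c1 * X by apply: le_trans hR'; rewrite ler_peMr ?exprn_ege1 // ltW.
  have h2 : R * S ^+ 2 <= X / 10.
    by apply: le_trans hRS'; rewrite ler_peMr ?exprn_ege1 // mulr_ge0 ?sqr_ge0 // ltW.
  have -> : 2 * R * (2 * S) = 4 * (R * S) by ring.
  rewrite -mulrA ler_pM2l // -ler_sqr ?nnegrE ?mulr_ge0 ?(ltW R0) ?(ltW S0) ?(ltW X0)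
    ?(ltW c10) //.
  have -> : (R * S) ^+ 2 = R * (R * S ^+ 2) by ring.
  rewrite [leRHS]expr2; apply: ler_pM => //; first exact: ltW.
    by rewrite mulr_ge0 ?sqr_ge0 // ltW.
  have : X * 1 <= X * c1 by rewrite ler_pM2l.
  by move: X0 h2; clear; lra.
have Xi0 : 0 <= Cx * T by rewrite mulr_ge0 ?powR_ge0.
have := type_I_sum_bound X1 x1 x6X R0 S0 al0 c11 hR' hRS' L1 LX tau1 htau minor Xi0 hXi.
rewrite cabsE lecR -Ekc => /le_trans; apply.
have -> : X `^ (1 - sigma + epsilon) = X / x * T ^+ 6.
  rewrite powRD; last by rewrite (gt_eqF X0) implybT.
  rewrite Xsub; congr (_ * _); rewrite /T -powR_mulrn ?powR_ge0 // -powRrM.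
  by congr (_ `^ _); rewrite /eta; field.
have -> : Cx * T * (kc * c1 * (CL * T) ^+ 2 * (Ct * T) ^+ 3 * (X / x)) =
  Cx * (kc * c1 * CL ^+ 2 * Ct ^+ 3) * (X / x * T ^+ 6) by ring.
rewrite ler_wpM2r //.
  by rewrite !mulr_ge0 ?invr_ge0 ?exprn_ge0 ?(ltW X0) ?(ltW x0) ?powR_ge0.
by rewrite ler_wpM2r ?(ltW Z0) // lerDl.
Qed.
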